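(* Let $t>0$. Let $X_0=t$ and, for $n\ge1$, let $X_n$ be the corange-box area of the $n$-th upper record (upper records ordered from left to right), with $X_n=0$ if there are fewer than $n$ upper records. Then $(X_n)_{n\ge0}$ is a Markov chain whose law coincides with that of the $Q$-process started at $t$.
   Context: Let $R=[0,t]\times[0,1]$ carry a homogeneous Poisson point process of unit intensity (atoms), and let $H$ be a horizontal line at height $h$ uniformly distributed on $[0,1]$, independent of the process. An upper record is an atom $a$ below $H$ that is higher than every atom below $H$ lying to the left of $a$. A lower record is an atom $b$ above $H$ that is lower than every atom above $H$ lying to the left of $b$. For an upper record $a=(x_a,y_a)$, its adjoint lower record is the rightmost lower record to the left of $a$, if any. The corange at $a$ is $y_b-y_a$ if the adjoint lower record $b=(x_b,y_b)$ exists, and $1-y_a$ otherwise (the length of the interval of heights of $H$ consistent with the observations up to $a$). The corange-box area at $a$ is $(t-x_a)$ times the corange at $a$. The $Q$-process is the Markov chain on $[0,\infty)$ with $0$ absorbing, which from a state $x>0$ moves to $(x-E)U_1$ if $E<xU_2$ and to $0$ otherwise, where $E$ is standard exponential and $U_1,U_2$ are uniform on $[0,1]$, all independent. *)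

(* Defs.v *)
From HB Require Import structures.
From mathcomp Require Import all_boot all_order all_algebra.
From mathcomp Require Import all_classical all_reals all_analysis.
Set Implicit Arguments. Unset Strict Implicit. Unset Printing Implicit Defensive.
Import Order.TTheory GRing.Theory Num.Theory.
Local Open Scope classical_set_scope.
Local Open Scope ring_scope.

Section Records.
Variable R : realType.
Implicit Types (t h : R) (pts : seq (R * R)).

(* an atom is a point (x, y) of the rectangle; h is the height of the line H *)

Definition is_upper_record h pts (a : R * R) : bool :=
  (a.2 < h) && all (fun c => (c.2 < h) && (c.1 < a.1) ==> (c.2 < a.2)) pts.

Definition is_lower_record h pts (b : R * R) : bool :=
  (h < b.2) && all (fun c => (h < c.2) && (c.1 < b.1) ==> (b.2 < c.2)) pts.

Definition by_x (p q : R * R) : bool := p.1 <= q.1.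

Definition upper_records h pts := sort by_x [seq a <- pts | is_upper_record h pts a].
Definition lower_records h pts := sort by_x [seq b <- pts | is_lower_record h pts b].

Definition adjoint h pts (a : R * R) : option (R * R) :=
  match [seq b <- lower_records h pts | b.1 < a.1] with
  | [::] => None
  | b0 :: l => Some (last b0 l)
  end.

Definition corange h pts (a : R * R) : R :=
  match adjoint h pts a with
  | Some b => b.2 - a.2
  | None => 1 - a.2
  end.

Definition corange_box_area t h pts (a : R * R) : R := (t - a.1) * corange h pts a.

Definition Xseq t h pts (n : nat) : R :=
  match n with
  | 0 => t
  | n'.+1 => match onth (upper_records h pts) n' with
             | Some a => corange_box_area t h pts a
             | None => 0
             end
  end.

End Records.

Section Laws.
Variable R : realType.
Local Notation leb := (@lebesgue_measure R).
Local Open Scope ereal_scope.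

Fixpoint int_pts (t : R) (k : nat) (F : seq (R * R) -> \bar R) : \bar R :=
  match k with
  | 0 => F [::]
  | k'.+1 =>
      \int[leb]_(x in [set x : R | (0 <= x <= t)%R])
        \int[leb]_(y in [set y : R | (0 <= y <= 1)%R])
          int_pts t k' (fun s => F ((x, y) :: s))
  end.

(* expectation of F(atoms) for a unit-intensity Poisson point process on
   [0,t]x[0,1] (Janossy densities: e^{-t}/k! on ordered k-tuples) *)
Definition ppp_expect (t : R) (F : seq (R * R) -> \bar R) : \bar R :=
  \sum_(k <oo) ((expR (- t) / (k`!)%:R)%:E * int_pts t k F).

(* P(X_0 in B_0, ..., X_n in B_n), with h uniform on [0,1] independent *)
Definition records_fdd (t : R) (n : nat) (B : nat -> set R) : \bar R :=
  \int[leb]_(h in [set h : R | (0 <= h <= 1)%R])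
    ppp_expect t (fun pts =>
      (\prod_(i < n.+1) \1_(B i) (Xseq t h pts i))%:E).

Definition qnext (x e u1 u2 : R) : R :=
  if (e < x * u2)%R then ((x - e) * u1)%R else 0%R.

(* P_x(Q_1 in B_0, ..., Q_n in B_(n-1)) *)
Fixpoint qfdd (n : nat) (B : nat -> set R) (x : R) : \bar R :=
  match n with
  | 0 => 1
  | n'.+1 =>
      \int[leb]_(e in [set e : R | (0 <= e)%R])
        ((expR (- e))%:E *
         \int[leb]_(u1 in [set u : R | (0 <= u <= 1)%R])
           \int[leb]_(u2 in [set u : R | (0 <= u <= 1)%R])
             ((\1_(B 0) (qnext x e u1 u2))%:E *
              qfdd n' (fun i => B i.+1) (qnext x e u1 u2)))
  end.

Definition Q_fdd (x : R) (n : nat) (B : nat -> set R) : \bar R :=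
  (\1_(B 0) x)%:E * qfdd n (fun i => B i.+1) x.

End Laws.

(* Main.v *)
(* Explore the atoms from left to right. Given the heights l < u of the last
   upper and lower records, H is uniform on ]l, u[, and an atom of height y in
   ]l, u[ turns the band into ]y, u[ or ]l, y[ with weights u - y and y - l.
   Hence the law of the areas, averaged over H, depends on the band only through
   its width and satisfies a linear integral equation obtained by conditioning
   on the first atom. The fdd of the Q-process, multiplied by the width of the
   band and the exponential of the remaining length, satisfy the same equation,
   and iterating it N times leaves a remainder of order t^N / N!. *)
Require Import Defs.
From HB Require Import structures.
From mathcomp Require Import all_boot all_order all_algebra.
From mathcomp Require Import all_classical all_reals all_analysis.
From mathcomp Require Import measurable_realfun ring lra.
Import Order.TTheory GRing.Theory Num.Theory.
Import numFieldNormedType.Exports.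
Local Open Scope classical_set_scope.
Local Open Scope ring_scope.

(** The Poisson expectation is given on unordered tuples, so their [k]! orderings must be collapsed
    before there is a first atom; ties of abscissas and boundary points are discarded as null sets.
    Integrals over [h] stay unnormalised: nothing is divided by the width, the weights [u - y] and
    [y - l] appear as lengths, and summing over the number of atoms in a box of length [s] and
    height 1, with a band of width [c], gives total mass [c * expR s]. These are the factors
    attached to the Q-process at state [s * c]. The Q-process fits because, given [E = e], the
    variable [x U2 - e] on the event [e < x U2] and the variable [(x - e) U1] are both uniform on
    ]0, x - e[; the geometry produces the former, with [x U2 = s * w], and the definition uses the
    latter. Multiplied by [c * expR s], one step of Q becomes an integral over coranges in ]0, c[ of
    a kernel that does not involve [c], so that the contributions of sub-bands can be added. *)

(** * Measurability of composite functions *)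

Section MeasurableCombinators.
Context {d : measure_display} {T : measurableType d} {R : realType}.
Implicit Types (f g : T -> R) (F G : T -> \bar R) (b c : T -> bool).

Lemma mf_add f g : measurable_fun setT f -> measurable_fun setT g ->
  measurable_fun setT (fun w => f w + g w).
Proof. exact: measurable_funD. Qed.
Lemma mf_sub f g : measurable_fun setT f -> measurable_fun setT g ->
  measurable_fun setT (fun w => f w - g w).
Proof. exact: measurable_funB. Qed.
Lemma mf_mul f g : measurable_fun setT f -> measurable_fun setT g ->
  measurable_fun setT (fun w => f w * g w).
Proof. exact: measurable_funM. Qed.
Lemma mf_opp f : measurable_fun setT f -> measurable_fun setT (fun w => - f w).
Proof. exact: measurable_funN. Qed.
Lemma mf_expR f : measurable_fun setT f ->
  measurable_fun setT (fun w => expR (f w)).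
Proof. by move=> mf; apply: measurableT_comp mf; exact: measurable_expR. Qed.
Lemma mf_exprn f n : measurable_fun setT f ->
  measurable_fun setT (fun w => f w ^+ n).
Proof. exact: measurable_funX. Qed.
Lemma mf_norm f : measurable_fun setT f -> measurable_fun setT (fun w => `|f w|).
Proof. by move=> mf; apply: measurableT_comp mf; exact: normr_measurable. Qed.
Lemma mf_indic (A : set R) f : measurable A -> measurable_fun setT f ->
  measurable_fun setT (fun w => \1_A (f w) : R).
Proof. by move=> mA mf; apply: measurableT_comp mf; exact: measurable_indic. Qed.
Lemma mf_EFin f : measurable_fun setT f -> measurable_fun setT (fun w => (f w)%:E).
Proof. by move=> /measurable_EFinP. Qed.
Lemma mf_adde F G : measurable_fun setT F -> measurable_fun setT G ->
  measurable_fun setT (fun w => F w + G w)%E.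
Proof. exact: emeasurable_funD. Qed.
Lemma mf_mule F G : measurable_fun setT F -> measurable_fun setT G ->
  measurable_fun setT (fun w => F w * G w)%E.
Proof. exact: emeasurable_funM. Qed.
Lemma mf_lt f g : measurable_fun setT f -> measurable_fun setT g ->
  measurable_fun setT (fun w => f w < g w).
Proof. exact: measurable_fun_ltr. Qed.
Lemma mf_le f g : measurable_fun setT f -> measurable_fun setT g ->
  measurable_fun setT (fun w => f w <= g w).
Proof. exact: measurable_fun_ler. Qed.
Lemma mf_and b c : measurable_fun setT b -> measurable_fun setT c ->
  measurable_fun setT (fun w => b w && c w).
Proof. exact: measurable_and. Qed.
Lemma mf_if {d'} {T' : measurableType d'} b (F G : T -> T') :
  measurable_fun setT b ->
  measurable_fun setT F -> measurable_fun setT G ->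
  measurable_fun setT (fun w => if b w then F w else G w).
Proof. exact: measurable_fun_ifT. Qed.
Lemma mf_fst {d1 d2} {T1 : measurableType d1} {T2 : measurableType d2}
  (f : T -> T1 * T2) : measurable_fun setT f -> measurable_fun setT (fun w => (f w).1).
Proof. by move=> mf; apply: measurableT_comp mf; exact: measurable_fst. Qed.
Lemma mf_snd {d1 d2} {T1 : measurableType d1} {T2 : measurableType d2}
  (f : T -> T1 * T2) : measurable_fun setT f -> measurable_fun setT (fun w => (f w).2).
Proof. by move=> mf; apply: measurableT_comp mf; exact: measurable_snd. Qed.
Lemma mf_pair {d1 d2} {T1 : measurableType d1} {T2 : measurableType d2}
  (f : T -> T1) (g : T -> T2) : measurable_fun setT f -> measurable_fun setT g ->
  measurable_fun setT (fun w => (f w, g w)).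
Proof. exact: measurable_fun_pair. Qed.
Lemma mf_comp {d1 d2} {T1 : measurableType d1} {T2 : measurableType d2}
  (f : T1 -> T2) (g : T -> T1) : measurable_fun setT f -> measurable_fun setT g ->
  measurable_fun setT (fun w => f (g w)).
Proof. exact: measurableT_comp. Qed.

End MeasurableCombinators.

Ltac mf_step := first
  [ exact: measurable_id | exact: measurable_cst | assumption
  | lazymatch goal with
    | |- measurable_fun _ (fun _ => _) => idtac
    | |- measurable_fun ?D ?f => change (measurable_fun D (fun w => f w))
    end;
    match goal with
    | |- measurable_fun _ (fun w => if _ then _ else _) => apply: mf_if
    | |- measurable_fun _ (fun w => (_ < _)%R) => apply: mf_lt
    | |- measurable_fun _ (fun w => (_ <= _)%R) => apply: mf_le
    | |- measurable_fun _ (fun w => _ && _) => apply: mf_and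
    | |- measurable_fun _ (fun w => (_, _)) => apply: mf_pair
    | |- measurable_fun _ (fun w => @GRing.add _ _ _) => first [apply: mf_sub | apply: mf_add | apply: mf_adde]
    | |- measurable_fun _ (fun w => (_ * _)%E) => apply: mf_mule
    | |- measurable_fun _ (fun w => EFin _) => apply: mf_EFin
    | |- measurable_fun _ (fun w => (- _)%R) => apply: mf_opp
    | |- measurable_fun _ (fun w => (_ * _)%R) => apply: mf_mul
    | |- measurable_fun _ (fun w => (_ ^+ _)%R) => apply: mf_exprn
    | |- measurable_fun _ (fun w => expR _) => apply: mf_expR
    | |- measurable_fun _ (fun w => `|_|%R) => apply: mf_norm
    | |- measurable_fun _ (fun w => \1_ _ _) => apply: mf_indic
    | |- measurable_fun _ (fun w => fst _) => apply: mf_fst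
    | |- measurable_fun _ (fun w => snd _) => apply: mf_snd
    end ].
Ltac mf := repeat mf_step.

(** * Integrals over the whole real line *)

Section LineIntegral.
Context {R : realType}.
Local Notation leb := (@lebesgue_measure R).
Local Open Scope ereal_scope.

(** Domains of integration are encoded as an [if] in the integrand, so that exchanges of integrals
    and changes of variables never have to handle a domain that depends on another variable. *)
Definition lint (f : R -> \bar R) : \bar R := \int[leb]_x f x.

Lemma lint_ext (f g : R -> \bar R) : (forall x, f x = g x) -> lint f = lint g.
Proof. by move=> fg; congr lint; apply/funext. Qed.

Lemma lint_ge0 f : (forall x, 0 <= f x) -> 0 <= lint f.
Proof. by move=> f0; apply: integral_ge0 => x _. Qed.

Lemma lint_bool (b : R -> bool) (f : R -> \bar R) :
  \int[leb]_(x in [set x | b x]) f x = lint (fun x => if b x then f x else 0).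
Proof.
rewrite integral_mkcond; apply: eq_integral => x _.
by rewrite patchE; congr (if _ then _ else _); rewrite mem_setE.
Qed.

Lemma lint0 : lint (fun=> 0) = 0.
Proof. exact: integral0. Qed.

Lemma lintD f g : (forall x, 0 <= f x) -> (forall x, 0 <= g x) ->
  measurable_fun setT f -> measurable_fun setT g ->
  lint (fun x => f x + g x) = lint f + lint g.
Proof. by move=> f0 g0 mf mg; rewrite /lint ge0_integralD. Qed.

Lemma lintZ k f : 0 <= k -> (forall x, 0 <= f x) -> measurable_fun setT f ->
  lint (fun x => k * f x) = k * lint f.
Proof. by move=> k0 f0 mf; rewrite /lint ge0_integralZl. Qed.

Lemma lintZr k f : 0 <= k -> (forall x, 0 <= f x) -> measurable_fun setT f ->
  lint (fun x => f x * k) = lint f * k.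
Proof.
by move=> k0 f0 mf; under lint_ext do rewrite muleC; rewrite lintZ// muleC.
Qed.

Lemma lint_le f g : (forall x, 0 <= f x) ->
  measurable_fun setT f -> measurable_fun setT g ->
  (forall x, f x <= g x) -> lint f <= lint g.
Proof. by move=> f0 mf mg fg; apply: ge0_le_integral => // x _; apply: le_trans (f0 x) (fg x). Qed.

Lemma lint_nneseries (f : nat -> R -> \bar R) : (forall k x, 0 <= f k x) ->
  (forall k, measurable_fun setT (f k)) ->
  lint (fun x => \sum_(k <oo) f k x) = \sum_(k <oo) lint (f k).
Proof. by move=> f0 mf; rewrite /lint integral_nneseries. Qed.

Lemma lint_if (b : bool) f :
  lint (fun x => if b then f x else 0) = if b then lint f else 0.
Proof. by case: b; rewrite ?lint0. Qed.

Lemma mf_lint {d} {T : measurableType d} (f : T * R -> \bar R) :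
  (forall z, 0 <= f z) -> measurable_fun setT f ->
  measurable_fun setT (fun z => lint (fun x => f (z, x))).
Proof. by move=> f0 mf; exact: (measurable_fun_fubini_tonelli_F (m2 := leb) f). Qed.

Lemma lint_swap (f : R -> R -> \bar R) : (forall x y, 0 <= f x y) ->
  measurable_fun setT (fun z : R * R => f z.1 z.2) ->
  lint (fun x => lint (fun y => f x y)) = lint (fun y => lint (fun x => f x y)).
Proof.
move=> f0 mf; exact: (fubini_tonelli (m1 := leb) (m2 := leb) (fun z => f z.1 z.2)).
Qed.

(** Points are null sets; [f] inherits its measurability from [g]. This is the tool that discards
    interval endpoints, ties of abscissas and atoms lying on the line H. *)
Lemma lint_eq_off (s : seq R) (f g : R -> \bar R) :
  measurable_fun setT g -> (forall x, x \notin s -> f x = g x) -> lint f = lint g.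
Proof.
elim: s f => [|a s IH] f mg fg; first by apply: lint_ext => x; exact: fg.
pose f' x := if x == a then g x else f x.
have f'g : lint f' = lint g.
  apply: IH => // x xs; rewrite /f'; case: eqVneq => // xa.
  by apply: fg; rewrite inE negb_or xa.
have mf' : measurable_fun setT f'.
  (* [f'] is recovered from the measurable [g] by correcting finitely many values. *)
  have : forall r : seq R, measurable_fun setT (fun x => if x \in r then f x else g x).
    elim => [|b r IHr]; first by mf.
    rewrite [X in measurable_fun _ X](_ : _ = fun x => if x == b then f b else if x \in r then f x else g x).
      by apply: mf_if; [apply: measurable_fun_eqr; mf|mf|mf].
    by apply/funext => x; rewrite inE; case: eqVneq => //= ->.
  move=> /(_ [seq x <- s | x != a]); congr (measurable_fun _ _).
  apply/funext => x; rewrite /f' mem_filter.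
  case: eqVneq => //= xa; case: ifPn => // xs.
  by rewrite fg// inE negb_or xa.
rewrite -f'g /lint -(@integral_setD1 _ f a)//; last 2 first.
- exact: measurableD.
- apply: (eq_measurable_fun f'); last exact: measurable_funTS.
  by move=> x; rewrite inE /= /f' => -[_ /eqP/negbTE ->].
rewrite -(@integral_setD1 _ f' a)//; last 2 first.
- exact: measurableD.
- exact: measurable_funTS.
by apply: eq_integral => x; rewrite inE /= /f' => -[_ /eqP/negbTE ->].
Qed.

End LineIntegral.

Ltac nn := repeat first
  [ done | exact: expR_ge0 | assumption | progress intros
  | match goal with
    | |- is_true (Order.le _ (if _ then _ else _)%E) => case: ifP => _
    | |- is_true (Order.le _ (@GRing.add _ _ _)) => first [apply: addr_ge0 | apply: adde_ge0]
    | |- is_true (Order.le _ (_ * _)%E) => apply: mule_ge0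
    | |- is_true (Order.le _ (lint _)) => apply: lint_ge0
    | |- is_true (Order.le _ (_ %:E)%E) => rewrite lee_fin
    | |- is_true (Order.le _ (_ * _)%R) => apply: mulr_ge0
    | |- is_true (Order.le _ (\1_ _ _)%R) => rewrite indicE ler0n
    end ].

(** * Affine changes of variables and explicit integrals *)

Section AffineChanges.
Context {R : realType}.
Local Notation leb := (@lebesgue_measure R).
Local Open Scope ereal_scope.

Implicit Types (f : R -> \bar R).

Lemma mf_lint2 {d} {T : measurableType d} (f : T -> R -> \bar R) :
  (forall z x, 0 <= f z x) -> measurable_fun setT (fun p : T * R => f p.1 p.2) ->
  measurable_fun setT (fun z => lint (f z)).
Proof. by move=> f0 mf; exact: (@mf_lint _ _ _ (fun p => f p.1 p.2)). Qed.

Lemma lint_opp f : (forall x, 0 <= f x) -> measurable_fun setT f ->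
  lint (fun x => f (- x)%R) = lint f.
Proof.
move=> f0 mf; rewrite /lint.
have mN : measurable_fun setT (-%R : R -> measurableTypeR R).
  by apply: mf_opp; mf.
transitivity (\int[pushforward leb (-%R : R -> measurableTypeR R)]_(y in setT) f y).
  by rewrite ge0_integral_pushforward.
by apply: eq_measure_integral => A mA _; exact: lebesgue_measureN.
Qed.

(** The image of Lebesgue measure under the affine map, scaled by [b], gives half-open intervals
    their length, hence is Lebesgue measure by uniqueness. *)
Lemma lint_affine_gt0 (b d : R) f : (0 < b)%R -> (forall x, 0 <= f x) ->
  measurable_fun setT f -> b%:E * lint (fun x => f (b * x + d)%R) = lint f.
Proof.
move=> b0 f0 mf; rewrite /lint.
pose phi := (fun x : R => b * x + d)%R : R -> measurableTypeR R.
have mphi : measurable_fun setT phi by rewrite /phi; mf.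
pose k := NngNum (ltW b0).
pose mu0 := mscale k (pushforward leb phi).
pose mu : {measure set (measurableTypeR R) -> \bar R} := mu0 mphi.
have muE A : measurable A -> leb A = mu A.
  apply: (@lebesgue_measure_unique R mu) => _ [[p q]] _ <-.
  rewrite /mu /mu0 /= /mscale/= /pushforward.
  have -> : phi @^-1` `]p, q] = `]((p - d) / b)%R, ((q - d) / b)%R]%classic.
    apply/seteqP; split => x; rewrite /phi /= !in_itv/=;
    rewrite ltr_pdivrMr// ler_pdivlMr// ltrBlDr lerBrDr (mulrC x b) //.
  rewrite !lebesgue_measure_itv/= !lte_fin ltr_pM2r ?invr_gt0// ltrD2r.
  case: ifP => _; last by rewrite mule0.
  by rewrite -!EFinB -EFinM; congr EFin; field; rewrite gt_eqF.
have -> : \int[leb]_x f x = \int[mu]_x f x.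
  by apply: eq_measure_integral => A mA _; first [exact: muE | exact/esym/muE].
rewrite /mu /mu0 ge0_integral_mscale// ge0_integral_pushforward//.
Qed.

Lemma lint_affine (b d : R) f : b != 0%R -> (forall x, 0 <= f x) ->
  measurable_fun setT f -> `|b|%:E * lint (fun x => f (b * x + d)%R) = lint f.
Proof.
move=> b0 f0 mf; have [bp|bn] := ltP 0%R b.
  by rewrite gtr0_norm// lint_affine_gt0.
have bn' : (0 < - b)%R by rewrite oppr_gt0 lt_neqAle b0.
rewrite ler0_norm// -[RHS](@lint_affine_gt0 (- b) d)//; congr (_ * _).
rewrite -lint_opp//; last by apply: mf_comp => //; mf.
by apply: lint_ext => x; rewrite mulrN mulNr.
Qed.

Lemma lint_shift (d : R) f : (forall x, 0 <= f x) -> measurable_fun setT f ->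
  lint (fun x => f (x + d)%R) = lint f.
Proof.
move=> f0 mf; rewrite -[RHS](@lint_affine 1 d)// normr1 mul1e.
by apply: lint_ext => x; rewrite mul1r.
Qed.

Lemma lint_refl (d : R) f : (forall x, 0 <= f x) -> measurable_fun setT f ->
  lint (fun x => f (d - x)%R) = lint f.
Proof.
move=> f0 mf; rewrite -[RHS](@lint_affine (-1) d)// ?oppr_eq0 ?oner_eq0//.
rewrite normrN1 mul1e.
by apply: lint_ext => x; congr f; rewrite mulN1r addrC.
Qed.

Lemma lint_itvoo (a b : R) : (a <= b)%R ->
  lint (fun x => if (a < x < b)%R then 1 else 0) = (b - a)%:E.
Proof.
move=> ab; rewrite -(lint_bool (fun x => a < x < b)%R (fun=> 1)).
have -> : [set x : R | (a < x < b)%R] = `]a, b[%classic.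
  by apply/seteqP; split => x /=; rewrite in_itv.
rewrite integral_cst//= mul1e lebesgue_measure_itv/= lte_fin EFinB.
by case: ltP => // ba; have -> : b = a; [apply/le_anti; rewrite ab ba|rewrite -EFinB subrr].
Qed.

Lemma lint_FTC (f F : R -> R) (a b : R) : (a <= b)%R ->
  (forall x, is_derive x (1%R : R) F (f x)) -> continuous f ->
  lint (fun x => if (a < x < b)%R then (f x)%:E else 0) = (F b - F a)%:E.
Proof.
move=> ab dF cf; rewrite -(lint_bool (fun x => a < x < b)%R (fun x => (f x)%:E)).
have -> : [set x : R | (a < x < b)%R] = `]a, b[%classic.
  by apply/seteqP; split => x /=; rewrite in_itv.
move: ab; rewrite le_eqVlt => /predU1P[<-|ab].
  by rewrite set_itv_ge ?bnd_simp ?ltxx// integral_set0 subrr.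
have eF x : derivable F x 1%R by have [] := dF x.
have cF : continuous F.
  by move=> x; apply/differentiable_continuous/derivable1_diffP; exact: eF.
rewrite -(@integral_itv_bndoo _ _ _ _ true false); last first.
  apply/measurable_EFinP; apply: measurable_funTS.
  exact: continuous_measurable_fun.
rewrite (@continuous_FTC2 _ f F)//.
- by apply: continuous_subspaceT => x; exact: cf.
- split.
  + by move=> x _; exact: eF.
  + by apply: cvg_at_right_filter; exact: cF.
  + by apply: cvg_at_left_filter; exact: cF.
- by move=> x _; rewrite derive1E; have [] := dF x.
Qed.

Lemma lint_pow n (s : R) : (0 <= s)%R ->
  lint (fun x => if (0 < x < s)%R then (x ^+ n / n`!%:R)%:E else 0)
  = (s ^+ n.+1 / n.+1`!%:R)%:E.
Proof.
move=> s0.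
have ne (m : nat) : (m`!%:R : R) != 0%R by rewrite pnatr_eq0 -lt0n fact_gt0.
have dF (x : R) : is_derive x (1%R : R) (fun x : R => x ^+ n.+1 / n.+1`!%:R)%R
    (x ^+ n / n`!%:R)%R.
  have -> : (fun x : R => x ^+ n.+1 / n.+1`!%:R)%R = (n.+1`!%:R^-1 *: (id ^+ n.+1 : R -> R))%R.
    by apply/funext => y; rewrite [RHS]mulrC /= exprfctE.
  apply: is_derive_eq.
  rewrite /GRing.scale/= factS natrM mulr1.
  by field; rewrite ne/= addrC natr1 pnatr_eq0.
rewrite (lint_FTC _ _ _ _ s0 dF)//.
- by rewrite expr0n/= mul0r subr0.
- by move=> x; apply: cvgM; [exact: exprn_continuous|exact: cvg_cst].
Qed.

Lemma lint_expR (a q s : R) : (q <= s)%R ->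
  lint (fun r => if (q < r < s)%R then (a * expR ((r - q) * a))%:E else 0)
  = (expR ((s - q) * a) - 1)%:E.
Proof.
move=> qs.
have dF (x : R) : is_derive x (1%R : R) (fun r : R => expR ((r - q) * a))%R
    (a * expR ((x - q) * a))%R.
  have -> : (fun r : R => expR ((r - q) * a))%R = expR \o (a *: (id - cst q : R -> R))%R.
    by apply/funext => y /=; rewrite mulrC.
  apply: is_derive_eq.
  by rewrite subr0 /GRing.scale/= mulr1 mulrC; congr (_ * expR _)%R; exact: mulrC.
rewrite (lint_FTC _ _ _ _ qs dF)//.
- by rewrite subrr mul0r expR0.
- move=> x; apply: cvgM; first exact: cvg_cst.
  have dd : differentiable (fun r : R => expR ((r - q) * a))%R x.
    by apply/derivable1_diffP; have [] := dF x.
  exact: differentiable_continuous dd.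
Qed.

Lemma lint_expN_tail (a : R) :
  lint (fun e => if (a <= e)%R then (expR (- e))%:E else 0) = (expR (- a))%:E.
Proof.
have E0 : lint (fun e : R => if (0 <= e)%R then (expR (- e))%:E else 0) = 1.
  rewrite -(@integral_exponential_pdf R 1%R)// /lint.
  apply: eq_integral => e _.
  rewrite /exponential_pdf patchE mem_setE in_itv/= andbT.
  by case: ifP => _ //; rewrite mul1r mulN1r.
rewrite -(@lint_shift a); [|by nn|by mf].
rewrite -[RHS]mule1 -E0 -lintZ; [|by nn|by nn|by mf].
apply: lint_ext => e; rewrite lerDr; case: ifP => _; last by rewrite mule0.
by rewrite -EFinM -expRD opprD addrC.
Qed.

Lemma lint_unit : lint (fun u : R => if (0 <= u <= 1)%R then 1 else 0) = 1.
Proof.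
transitivity (lint (fun u : R => if (0 < u < 1)%R then 1 else 0)); last first.
  by rewrite lint_itvoo// subr0.
apply: (lint_eq_off [:: 0; 1]%R); first by mf.
move=> u; rewrite !inE negb_or => /andP[u0 u1].
by rewrite !le_eqVlt eq_sym (negbTE u0) (negbTE u1).
Qed.

End AffineChanges.

(* Otherwise rewriting with the lemmas above tries to unify integrands up to
   the definition of the integral. *)
Global Opaque lint.

(** * From unordered to ordered configurations of points *)

Section Configurations.
Context {R : realType}.
Local Open Scope ereal_scope.
Notation P := (R * R)%type.

Definition lint2 (F : P -> \bar R) : \bar R := lint (fun x => lint (fun y => F (x, y))).

Lemma lint2_ext (F G : P -> \bar R) : (forall p, F p = G p) -> lint2 F = lint2 G.
Proof. by move=> FG; apply: lint_ext => x; apply: lint_ext => y. Qed.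

Lemma lint2_ge0 F : (forall p, 0 <= F p) -> 0 <= lint2 F.
Proof. by move=> F0; apply: lint_ge0 => x; apply: lint_ge0. Qed.

Lemma lint20 : lint2 (fun=> 0) = 0.
Proof. by rewrite /lint2; under lint_ext do rewrite lint0; rewrite lint0. Qed.

Lemma mf_lint_at (F : P -> \bar R) : (forall p, 0 <= F p) ->
  measurable_fun setT F -> measurable_fun setT (fun x => lint (fun y => F (x, y))).
Proof.
move=> F0 mF; apply: (mf_lint2 (fun x y => F (x, y))) => //.
by apply: mf_comp => //; mf.
Qed.

Lemma mf_lint2P {d} {T : measurableType d} (F : T -> P -> \bar R) :
  (forall z p, 0 <= F z p) -> measurable_fun setT (fun q : T * P => F q.1 q.2) ->
  measurable_fun setT (fun z => lint2 (F z)).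
Proof.
move=> F0 mF.
apply: (mf_lint2 (fun z x => lint (fun y => F z (x, y)))) => [z x|]; first by nn.
apply: (mf_lint2 (fun (q : T * R) y => F q.1 (q.2, y))) => [//|].
by apply: (mf_comp (fun q : T * P => F q.1 q.2) (fun w : T * R * R => (w.1.1, (w.1.2, w.2)))) => //; mf.
Qed.

Lemma lint2D F G : (forall p, 0 <= F p) -> (forall p, 0 <= G p) ->
  measurable_fun setT F -> measurable_fun setT G ->
  lint2 (fun p => F p + G p) = lint2 F + lint2 G.
Proof.
move=> F0 G0 mF mG; rewrite /lint2 -lintD; [|by nn|by nn|exact: mf_lint_at|exact: mf_lint_at].
by apply: lint_ext => x; rewrite lintD// ; apply: mf_comp => //; mf.
Qed.

Lemma lint2Z k F : 0 <= k -> (forall p, 0 <= F p) ->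
  measurable_fun setT F -> lint2 (fun p => k * F p) = k * lint2 F.
Proof.
move=> k0 F0 mF; rewrite /lint2 -lintZ//; [|by nn|exact: mf_lint_at].
by apply: lint_ext => x; rewrite lintZ//; apply: mf_comp => //; mf.
Qed.

Lemma lint2_if (b : bool) F :
  lint2 (fun p => if b then F p else 0) = if b then lint2 F else 0.
Proof. by case: b; rewrite ?lint20. Qed.

Lemma lint2_swap1 (F : R -> P -> \bar R) : (forall x q, 0 <= F x q) ->
  measurable_fun setT (fun z : R * P => F z.1 z.2) ->
  lint (fun x => lint2 (F x)) = lint2 (fun q => lint (fun x => F x q)).
Proof.
move=> F0 mF; rewrite /lint2.
rewrite (@lint_swap _ (fun x x' => lint (fun y' => F x (x', y')))); [|by nn|].
- apply: lint_ext => x'; rewrite (@lint_swap _ (fun x y' => F x (x', y')))//.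
  by apply: (mf_comp (fun z : R * P => F z.1 z.2) (fun w : R * R => (w.1, (x', w.2)))) => //; mf.
- apply: (mf_lint2 (fun (z : R * R) y' => F z.1 (z.2, y'))) => //.
  by apply: (mf_comp (fun z : R * P => F z.1 z.2) (fun w : R * R * R => (w.1.1, (w.1.2, w.2)))) => //; mf.
Qed.

Lemma lint2_swap (F : P -> P -> \bar R) : (forall p q, 0 <= F p q) ->
  measurable_fun setT (fun z : P * P => F z.1 z.2) ->
  lint2 (fun p => lint2 (F p)) = lint2 (fun q => lint2 (fun p => F p q)).
Proof.
move=> F0 mF.
transitivity (lint (fun x => lint2 (fun q => lint (fun y => F (x, y) q)))).
  apply: lint_ext => x; rewrite (lint2_swap1 (fun y => F (x, y)))//.
  by apply: (mf_comp (fun z : P * P => F z.1 z.2) (fun w : R * P => ((x, w.1), w.2))) => //; mf.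
rewrite (lint2_swap1 (fun x q => lint (fun y => F (x, y) q)))//; first by nn.
apply: (mf_lint2 (fun (z : R * P) y => F (z.1, y) z.2)) => //.
by apply: (mf_comp (fun z : P * P => F z.1 z.2) (fun w : R * P * R => ((w.1.1, w.2), w.1.2))) => //; mf.
Qed.

(* Measurability of a family of functionals of finite point configurations,
   tested against all measurable parametrisations of the points. *)
Definition mseq {d} {T : measurableType d} (G : T -> seq P -> \bar R) :=
  forall d' (S : measurableType d') (a : S -> T) (ps : seq (S -> P)),
    measurable_fun setT a -> List.Forall (measurable_fun setT) ps ->
    measurable_fun setT (fun w => G (a w) [seq p w | p <- ps]).

Lemma mseq_comp {d d'} {T : measurableType d} {T' : measurableType d'}
  (G : T -> seq P -> \bar R) (a : T' -> T) :
  measurable_fun setT a -> mseq G -> mseq (fun z => G (a z)).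
Proof. by move=> ma mG ? S b ps mb mps; apply: mG mps; exact: (mf_comp a). Qed.

Lemma mseq_cons {d} {T : measurableType d} (G : T -> seq P -> \bar R) :
  mseq G -> mseq (fun (z : T * P) s => G z.1 (z.2 :: s)).
Proof.
move=> mG d' S b ps mb mps.
by apply: (mG _ S (fun w => (b w).1) ((fun w => (b w).2) :: ps)); [mf|constructor => //; mf].
Qed.

(** Insertion sort makes ordering compatible with induction on the number of points: one insertion
    corresponds to one more integration variable. *)
Fixpoint ins (p : P) (s : seq P) : seq P :=
  if s is q :: s' then if (p.1 < q.1)%R then p :: s else q :: ins p s' else [:: p].

Definition isort := foldr ins [::].

(** The first comparison cuts the parameter space into two measurable pieces; when the insertion
    goes further, the head of the list is moved into the parameter, which is why [T] varies in the
    induction. *)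
Lemma mseq_ins {d} {T : measurableType d} (G : T -> seq P -> \bar R) :
  mseq G -> mseq (fun (z : T * P) s => G z.1 (ins z.2 s)).
Proof.
move=> mG d' S a ps ma mps; elim: mps d T G mG a ma => [|q qs mq mqs IH] d T G mG a ma /=.
  by apply: (mseq_cons _ mG _ _ a [::]).
rewrite [X in measurable_fun _ X](_ : _ = fun w => if ((a w).2.1 < (q w).1)%R
  then G (a w).1 ((a w).2 :: q w :: [seq p w | p <- qs])
  else G (a w).1 (q w :: ins (a w).2 [seq p w | p <- qs])); last first.
  by apply/funext => w; case: ifP.
apply: mf_if; first by mf.
- by apply: (mG _ S (fun w => (a w).1) ((fun w => (a w).2) :: q :: qs)); [mf|repeat constructor => //; mf].
- by apply: (IH _ _ _ (mseq_cons _ mG) (fun w => ((a w).1, q w, (a w).2))); mf.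
Qed.

Lemma mseq_isort {d} {T : measurableType d} (G : T -> seq P -> \bar R) :
  mseq G -> mseq (fun z s => G z (isort s)).
Proof.
move=> mG d' S a ps ma mps; elim: mps d T G mG a ma => [|q qs mq mqs IH] d T G mG a ma /=.
  by apply: (mG _ S a [::]).
by apply: (IH _ _ _ (mseq_ins _ mG) (fun w => (a w, q w))); mf.
Qed.

Variable t : R.

Definition inbox (x0 : R) (p : P) : bool := (x0 < p.1 < t)%R && (0 < p.2 < 1)%R.

(* Integral of [G] over the configurations of [k] points of ]x0, t[ x ]0, 1[,
   listed by increasing abscissa. *)
Fixpoint Jord k (x0 : R) (G : seq P -> \bar R) : \bar R :=
  if k is k'.+1 then
    lint2 (fun p => if inbox x0 p then Jord k' p.1 (fun s => G (p :: s)) else 0)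
  else G [::].

Lemma JordS k x0 G :
  Jord k.+1 x0 G = lint2 (fun p => if inbox x0 p then Jord k p.1 (fun s => G (p :: s)) else 0).
Proof. by []. Qed.

Lemma Jord_ext k x0 G G' : (forall s, G s = G' s) -> Jord k x0 G = Jord k x0 G'.
Proof. by move=> GG'; congr Jord; apply/funext. Qed.

Lemma Jord_ge0 k x0 G : (forall s, 0 <= G s) -> 0 <= Jord k x0 G.
Proof.
elim: k x0 G => [|k IH] x0 G G0 /=; first exact: G0.
by apply: lint2_ge0 => p; case: ifP => // _; apply: IH.
Qed.

Lemma mf_inbox {d} {T : measurableType d} (b : T -> R) (p : T -> P) :
  measurable_fun setT b -> measurable_fun setT p ->
  measurable_fun setT (fun z => inbox (b z) (p z)).
Proof. by move=> mb mp; rewrite /inbox; mf. Qed.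

Lemma mf_Jord k {d} {T : measurableType d} (G : T -> seq P -> \bar R) (b : T -> R) :
  (forall z s, 0 <= G z s) -> mseq G -> measurable_fun setT b ->
  measurable_fun setT (fun z => Jord k (b z) (G z)).
Proof.
elim: k d T G b => [|k IH] d T G b G0 mG mb /=.
  by apply: (mG _ T id [::]).
apply: (mf_lint2P (fun z p => if inbox (b z) p then Jord k p.1 (fun s => G z (p :: s)) else 0)).
  by move=> z p; case: ifP => // _; apply: Jord_ge0.
apply: mf_if; [apply: mf_inbox; first apply: (mf_comp b)|..]; mf.
by apply: (IH _ _ (fun (q : T * P) s => G q.1 (q.2 :: s)) (fun q : T * P => q.2.1)) => //; [exact: mseq_cons|mf].
Qed.

(* A point added to an ordered configuration of [k] points falls into one of
   its [k + 1] gaps. *)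
Lemma Jord_ins k {d} {T : measurableType d} (G : T -> seq P -> \bar R) z x0 :
  (forall z s, 0 <= G z s) -> mseq G ->
  lint2 (fun p => if inbox x0 p then Jord k x0 (fun s => G z (ins p s)) else 0)
  = k.+1%:R%:E * Jord k.+1 x0 (G z).
Proof.
elim: k d T G z x0 => [|k IH] d T G z x0 G0 mG; first by rewrite mul1e.
(* [q] is the first point of the old configuration. In [A] the new point [p] comes before it, which
   yields one copy of the ordered integral; in [B] it comes later, and the induction hypothesis to
   the right of [q] yields the other [k + 1] copies. *)
pose A p q := if inbox x0 p && inbox p.1 q then Jord k q.1 (fun s => G z (p :: q :: s)) else 0.
pose B p q := if inbox x0 p && inbox x0 q && (q.1 <= p.1)%R
  then Jord k q.1 (fun s => G z (q :: ins p s)) else 0.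
have A0 p q : 0 <= A p q by rewrite /A; case: ifP => // _; apply: Jord_ge0.
have B0 p q : 0 <= B p q by rewrite /B; case: ifP => // _; apply: Jord_ge0.
have mA : measurable_fun setT (fun w : P * P => A w.1 w.2).
  apply: mf_if; [by apply: mf_and; apply: mf_inbox; mf| |by mf].
  apply: (mf_Jord k (fun (w : P * P) s => G z (w.1 :: w.2 :: s))) => //; last by mf.
  by apply: (mseq_comp _ (fun w : P * P => ((z, w.1), w.2)) _ (mseq_cons _ (mseq_cons _ mG))); mf.
have mB : measurable_fun setT (fun w : P * P => B w.1 w.2).
  apply: mf_if; [by apply: mf_and; [apply: mf_and; apply: mf_inbox|]; mf| |by mf].
  apply: (mf_Jord k (fun (w : P * P) s => G z (w.2 :: ins w.1 s))) => //; last by mf.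
  by apply: (mseq_comp _ (fun w : P * P => ((z, w.2), w.1)) _ (mseq_ins _ (mseq_cons _ mG))); mf.
have mA1 p : measurable_fun setT (A p) by apply: (mf_comp _ (fun q => (p, q)) mA); mf.
have mB1 p : measurable_fun setT (B p) by apply: (mf_comp _ (fun q => (p, q)) mB); mf.
transitivity (lint2 (fun p => lint2 (A p) + lint2 (B p))).
  apply: lint2_ext => p /=; rewrite -lint2_if -lint2D//; apply: lint2_ext => q.
  rewrite /A /B /inbox; case: (ltP p.1 q.1) => pq.
  - rewrite andbF adde0; case: p q pq => px py [qx qy] /= pq.
    case: (ltP x0 px) => //= xp; case: (ltP px t) => //= _.
    case: (0 < py)%R => //=; case: (py < 1)%R => //=.
    by rewrite (lt_trans xp pq).
  - rewrite andbF andbT add0e; case: ifP => //= _; case: ifP => // _.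
rewrite lint2D//; last 4 first.
- by move=> p; exact: lint2_ge0.
- by move=> p; exact: lint2_ge0.
- exact: (mf_lint2P A).
- exact: (mf_lint2P B).
rewrite (lint2_swap B)// [k.+2%:R]mulrS EFinD ge0_muleDl// mul1e; congr (_ + _).
  by apply: lint2_ext => p; rewrite -lint2_if; apply: lint2_ext => q; rewrite /A; case: inbox.
rewrite [Jord k.+2 _ _]JordS -lint2Z; last 3 first.
- by rewrite lee_fin.
- by move=> p; case: ifP => // _; apply: Jord_ge0.
- apply: mf_if; [by apply: mf_inbox; mf| |by mf].
  by apply: (mf_Jord k.+1 (fun (p : P) s => G z (p :: s))) => //; apply: (mseq_comp _ (fun p : P => (z, p)) _ (mseq_cons _ mG)); mf.
apply: lint2_ext => q.
have [iq|iq] := boolP (inbox x0 q); last first.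
  rewrite mule0 -lint20; apply: lint2_ext => p; rewrite /B (negbTE iq) andbF //.
rewrite -(IH _ _ (fun (w : T * P) s => G w.1 (w.2 :: s)) (z, q))//; last exact: mseq_cons.
pose C p := if inbox q.1 p then Jord k q.1 (fun s => G z (q :: ins p s)) else 0.
(* [B] allows equal abscissas and [inbox] does not; they differ on the null line through [q]. *)
apply: (lint_eq_off [:: q.1]).
  apply: (mf_lint_at C) => [p|]; first by rewrite /C; case: ifP => // _; apply: Jord_ge0.
  apply: mf_if; [by apply: mf_inbox; mf| |by mf].
  apply: (mf_Jord k (fun (w : P) s => G z (q :: ins w s))) => //.
  by apply: (mseq_comp _ (fun w : P => ((z, q), w)) _ (mseq_ins _ (mseq_cons _ mG))); mf.
move=> px; rewrite inE => pq; apply: lint_ext => py.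
rewrite /B iq andbT; congr (if _ then _ else _).
move: iq; rewrite /inbox /= => /andP[/andP[xq _] _]; rewrite le_eqVlt eq_sym (negbTE pq)/=.
case: (ltP q.1 px) => [qp|]; last by rewrite andbF.
by rewrite (lt_trans xq qp) andbT.
Qed.

Fixpoint Junord k (G : seq P -> \bar R) : \bar R :=
  if k is k'.+1 then
    lint2 (fun p => if inbox 0 p then Junord k' (fun s => G (p :: s)) else 0)
  else G [::].

(** The insertions contribute 1, 2, ..., [k] gaps in turn. The resulting factorial is what the
    Janossy density of the Poisson process divides by. *)
Lemma Junord_isort k {d} {T : measurableType d} (G : T -> seq P -> \bar R) z :
  (forall z s, 0 <= G z s) -> mseq G ->
  Junord k (fun s => G z (isort s)) = k`!%:R%:E * Jord k 0 (G z).
Proof.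
elim: k d T G z => [|k IH] d T G z G0 mG; first by rewrite mul1e.
rewrite factS mulnC natrM EFinM -muleA -Jord_ins// -lint2Z; last 3 first.
- by rewrite lee_fin.
- by move=> p; case: ifP => // _; apply: Jord_ge0.
- apply: mf_if; [by apply: mf_inbox; mf| |by mf].
  apply: (mf_Jord k (fun (w : P) s => G z (ins w s))) => //.
  by apply: (mseq_comp _ (fun w : P => (z, w)) _ (mseq_ins _ mG)); mf.
apply: lint2_ext => p; case: ifP => _; last by rewrite mule0.
by rewrite -(IH _ _ (fun (w : T * P) s => G w.1 (ins w.2 s)) (z, p))//; exact: mseq_ins.
Qed.

Lemma Junord_ge0 k G : (forall s, 0 <= G s) -> 0 <= Junord k G.
Proof.
elim: k G => [|k IH] G G0 /=; first exact: G0.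
by apply: lint2_ge0 => p; case: ifP => // _; apply: IH.
Qed.

Lemma mf_Junord k {d} {T : measurableType d} (G : T -> seq P -> \bar R) :
  (forall z s, 0 <= G z s) -> mseq G -> measurable_fun setT (fun z => Junord k (G z)).
Proof.
elim: k d T G => [|k IH] d T G G0 mG /=.
  by apply: (mG _ T id [::]).
apply: (mf_lint2P (fun z p => if inbox 0 p then Junord k (fun s => G z (p :: s)) else 0)).
  by move=> z p; case: ifP => // _; apply: Junord_ge0.
apply: mf_if; [apply: mf_inbox|..]; mf.
by apply: (IH _ _ (fun (q : T * P) s => G q.1 (q.2 :: s))) => //; exact: mseq_cons.
Qed.

(** The almost sure properties of a configuration; [xs] collects the abscissas of the points already
    integrated over, which later points must avoid. *)
Definition generic (xs : seq R) (s : seq P) : bool :=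
  uniq ([seq p.1 | p <- s] ++ xs) && all (fun p => 0 < p.2 < 1)%R s.

Lemma int_pts_Junord k F {d} {T : measurableType d} (G : T -> seq P -> \bar R) z xs :
  (forall z s, 0 <= G z s) -> mseq G -> uniq xs ->
  (forall s, generic xs s -> F s = G z s) -> int_pts t k F = Junord k (G z).
Proof.
elim: k F d T G z xs => [|k IH] F d T G z xs G0 mG uxs FG /=; first by apply: FG; rewrite /generic /= uxs.
rewrite (lint_bool (fun x => 0 <= x <= t)%R).
pose H p := if inbox 0 p then Junord k (fun s => G z (p :: s)) else 0.
have mH : measurable_fun setT H.
  apply: mf_if; [by apply: mf_inbox; mf| |by mf].
  apply: (mf_Junord k (fun (p : P) s => G z (p :: s))) => //.
  by apply: (mseq_comp _ (fun p : P => (z, p)) _ (mseq_cons _ mG)); mf.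
have H0 p : 0 <= H p.
  by rewrite /H; case: ifP => // _; apply: Junord_ge0.
(* The finitely many abscissas that would break genericity are removed: the two sides of the box and
   the points already placed. *)
apply: (lint_eq_off (0%R :: t :: xs)); first exact: (mf_lint_at H).
move=> x; rewrite !inE !negb_or => /and3P[x0 xt xxs].
have -> : (0 <= x <= t)%R = (0 < x < t)%R.
  by rewrite !lt_neqAle (eq_sym 0%R) x0 xt.
have mHx : measurable_fun setT (fun y => H (x, y)) by exact: (measurableT_comp mH (pair1_measurable x)).
rewrite /inbox /=; case: ifPn => xr; last by rewrite lint0.
rewrite (lint_bool (fun x => 0 <= x <= 1)%R).
apply: (lint_eq_off [:: 0; 1]%R); first by move: mHx; rewrite /H /inbox /= xr.
move=> y; rewrite !inE !negb_or => /andP[y0 y1].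
have -> : (0 <= y <= 1)%R = (0 < y < 1)%R.
  by rewrite !lt_neqAle (eq_sym 0%R) y0 y1.
rewrite /=; case: ifP => // yr.
apply: (IH _ _ _ (fun (q : T * P) s => G q.1 (q.2 :: s)) (z, (x, y)) (x :: xs)) => //=.
- exact: mseq_cons.
- by rewrite xxs.
- move=> s /andP[us ys]; apply: FG; rewrite /generic/= yr ys andbT.
  by move: us; rewrite -[x :: xs]/([:: x] ++ xs) uniq_catCA => us; rewrite andbT.
Qed.

End Configurations.

(** * The records read off by a left-to-right exploration *)

Section Emissions.
Context {R : realType}.
Variable t : R.
Notation P := (R * R)%type.
Implicit Types (h l u : R) (s pts pre suf : seq P).

(* The corange-box areas at the successive upper records: exploring the atoms
   from left to right, [l] and [u] are the heights of the last upper and lower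
   records met so far. *)
Fixpoint areas h l u s : seq R :=
  if s is p :: s' then
    if (l < p.2 < h) then (t - p.1) * (u - p.2) :: areas h p.2 u s'
    else if (h < p.2 < u) then areas h l p.2 s' else areas h l u s'
  else [::].

Definition lt_x (p q : P) : bool := p.1 < q.1.

Let lt_x_trans : transitive lt_x.
Proof. by move=> p q r; exact: lt_trans. Qed.

Lemma perm_ins (p : P) s : perm_eq (ins p s) (p :: s).
Proof.
elim: s => //= q s IH; case: ifP => // _.
apply: (perm_trans (y := q :: p :: s)); first by rewrite perm_cons.
by apply/permP => b /=; rewrite addnCA.
Qed.

Lemma perm_isort s : perm_eq (isort s) s.
Proof.
elim: s => //= p s IH; apply: (perm_trans (perm_ins _ _)).
by rewrite perm_cons.
Qed.

Lemma isort_sorted s : uniq [seq p.1 | p <- s] -> pairwise lt_x (isort s).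
Proof.
elim: s => //= p s IH /andP[ps us]; move: (IH us).
have {ps us IH} : p.1 \notin [seq q.1 | q <- isort s].
  by rewrite (perm_mem (perm_map fst (perm_isort s))).
elim: (isort s) => //= q r IH; rewrite inE negb_or => /andP[pq pr] /andP[qr wr].
case: ifP => [pq'|]/=.
  rewrite wr qr/= /lt_x pq'/= andbT.
  by apply/allP => c /(allP qr); exact: lt_trans.
move=> /negbT; rewrite -leNgt le_eqVlt eq_sym (negbTE pq)/= => qp.
by rewrite IH// andbT (perm_all _ (perm_ins p r))/= /lt_x qp.
Qed.

Lemma uniq_map_inj_in {A B : eqType} (f : A -> B) (r : seq A) :
  uniq [seq f a | a <- r] -> {in r &, injective f}.
Proof.
elim: r => //= a r IH /andP[ar ur] x y; rewrite !inE.
move=> /predU1P[->|xr] /predU1P[->|yr] fxy //; last exact: IH.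
- by move: ar; rewrite fxy map_f.
- by move: ar; rewrite -fxy map_f.
Qed.

(** Distinct abscissas make the preorder [by_x] antisymmetric on the points at hand, so the sorted
    list depends only on the set of points. *)
Lemma sort_by_x_perm (b b' : pred P) s s' : perm_eq s s' -> b =1 b' ->
  uniq [seq p.1 | p <- s] ->
  sort (@by_x R) [seq p <- s | b p] = sort (@by_x R) [seq p <- s' | b' p].
Proof.
move=> ss' bb' us; rewrite (eq_filter bb').
apply/perm_sort_inP; last exact: perm_filter.
- by move=> p q _ _; exact: le_total.
- by move=> p q r _ _ _; exact: le_trans.
- move=> p q; rewrite !mem_filter => /andP[_ ps] /andP[_ qs] pq.
  by apply: (uniq_map_inj_in fst s us) => //; apply: le_anti.
Qed.

Lemma Xseq_perm h s s' n : perm_eq s s' -> uniq [seq p.1 | p <- s] ->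
  Xseq t h s n = Xseq t h s' n.
Proof.
move=> ss' us; case: n => //= n.
have E1 : is_upper_record h s =1 is_upper_record h s'.
  by move=> a; rewrite /is_upper_record (perm_all _ ss').
have E2 : is_lower_record h s =1 is_lower_record h s'.
  by move=> a; rewrite /is_lower_record (perm_all _ ss').
rewrite /upper_records (sort_by_x_perm _ _ _ _ ss' E1 us).
case: onth => //= a; rewrite /corange_box_area /corange /adjoint /lower_records.
by rewrite (sort_by_x_perm _ _ _ _ ss' E2 us).
Qed.

Lemma sort_by_x_id (b : pred P) s : pairwise lt_x s ->
  sort (@by_x R) [seq p <- s | b p] = [seq p <- s | b p].
Proof.
move=> ws; apply: sorted_sort; first by move=> p q r; exact: le_trans.
apply: pairwise_sorted; apply: sub_pairwise (_ : pairwise lt_x _); last first.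
  exact: pairwise_filter.
by move=> p q; exact: ltW.
Qed.

(* [l] and [u] bound the heights still compatible with the atoms of [pre]; [u]
   is moreover the height of the last lower record of [pre], if any. *)
Definition explored h pre l u :=
  [/\ forall y, 0 < y -> all (fun c => (c.2 < h) ==> (c.2 < y)) pre = (l < y),
      forall y, y < 1 -> all (fun c => (h < c.2) ==> (y < c.2)) pre = (y < u) &
      last 1 [seq b.2 | b <- pre & is_lower_record h pre b] = u].

Lemma lower_record_cat h pre suf (b : P) : pairwise lt_x (pre ++ suf) -> b \in pre ->
  is_lower_record h (pre ++ suf) b = is_lower_record h pre b.
Proof.
rewrite pairwise_cat => /andP[/allrelP w _] bpre.
rewrite /is_lower_record all_cat [X in _ && (_ && X)](_ : _ = true) ?andbT//.
apply/allP => c csuf; have /ltW := w b c bpre csuf.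
by rewrite leNgt => /negbTE ->; rewrite andbF.
Qed.

(** Induction on the unexplored suffix, with [explored] as invariant: the comparisons with all
    previous atoms in the definition of a record reduce to comparisons with [l] and [u], and the
    adjoint of an upper record sits at height [u]. *)
Lemma areas_upper_records h s : 0 < h < 1 -> pairwise lt_x s ->
  all (fun p => 0 < p.2 < 1) s ->
  [seq corange_box_area t h s a | a <- upper_records h s] = areas h 0 1 s.
Proof.
move=> /andP[h0 h1] ws ys; rewrite /upper_records sort_by_x_id//.
pose Q pre suf l u := explored h pre l u -> pre ++ suf = s ->
  [seq corange_box_area t h s a | a <- suf & is_upper_record h s a] = areas h l u suf.
suff H suf pre l u : Q pre suf l u.
  (* Before any atom the [all] conditions hold vacuously, in agreement with [0 < y] and [y < 1]; the
     default 1 of [last] is the height used by [corange] when there is no adjoint. *)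
  by apply: (H s [::] 0 1) => //; split=> [y ->|y ->|].
elim: suf pre l u => [//|p suf IH] pre l u [El Eu Elast] Es.
have wp : all (lt_x^~ p) pre.
  by move: ws; rewrite -Es pairwise_cat allrel_consr -andbA => /andP[].
have wsuf : all (lt_x p) suf.
  by move: ws; rewrite -Es pairwise_cat /= => /and3P[_ _ /andP[]].
have /andP[y0 y1] : 0 < p.2 < 1.
  by apply: (allP ys); rewrite -Es mem_cat inE eqxx orbT.
(* Atoms of the suffix lie to the right of [p], so only those of [pre] are tested. *)
have before (b : pred P) : all (fun c => b c && (c.1 < p.1) ==> (c.2 < p.2)) s
   = all (fun c => b c ==> (c.2 < p.2)) pre.
  rewrite -Es all_cat /= ltxx andbF/= [X in _ && X](_ : _ = true) ?andbT.
    by apply: eq_in_all => c /(allP wp); rewrite /lt_x => ->; rewrite andbT.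
  apply/allP => c /(allP wsuf) /ltW; rewrite leNgt => /negbTE ->.
  by rewrite andbF.
have up : is_upper_record h s p = (l < p.2 < h).
  by rewrite /is_upper_record before El// andbC.
have low : is_lower_record h (rcons pre p) p = (h < p.2 < u).
  rewrite /is_lower_record; congr (_ && _).
  rewrite all_rcons ltxx andbF/= -Eu//.
  by apply: eq_in_all => c /(allP wp); rewrite /lt_x => ->; rewrite andbT.
have Es' : rcons pre p ++ suf = s by rewrite cat_rcons.
have adj : corange h s p = u - p.2.
  rewrite /corange /adjoint /lower_records sort_by_x_id//.
  rewrite -filter_predI -Elast.
  have -> : [seq b <- s | predI (fun b => b.1 < p.1) (is_lower_record h s) b] =
            [seq b <- pre | is_lower_record h pre b].
    rewrite -Es filter_cat [X in _ ++ X](_ : _ = [::]) ?cats0.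
      apply: eq_in_filter => b bpre /=; rewrite lower_record_cat ?Es//.
      by move: (allP wp b bpre); rewrite /lt_x => ->.
    rewrite /= ltxx /=; apply/eqP; rewrite -(negbK (_ == _)) -has_filter.
    apply/hasPn => b /(allP wsuf) /ltW; rewrite leNgt => /negbTE /= ->//.
  by case: [seq b <- pre | _] => //= b0 r; rewrite last_map.
have low_eq : [seq b <- pre | is_lower_record h (rcons pre p) b] =
              [seq b <- pre | is_lower_record h pre b].
  apply: eq_in_filter => b bpre; rewrite -cats1 lower_record_cat//.
  by move: ws; rewrite -Es' -cats1 pairwise_cat => /and3P[].
have Elast' : last 1 [seq b.2 | b <- rcons pre p & is_lower_record h (rcons pre p) b]
    = if h < p.2 < u then p.2 else u.
  rewrite filter_rcons low low_eq; case: ifP => _ //.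
  by rewrite map_rcons last_rcons.
have step l' u' :
    (forall y, 0 < y -> ((p.2 < h) ==> (p.2 < y)) && (l < y) = (l' < y)) ->
    (forall y, y < 1 -> ((h < p.2) ==> (y < p.2)) && (y < u) = (y < u')) ->
    (if h < p.2 < u then p.2 else u) = u' ->
    explored h (rcons pre p) l' u'.
  move=> H1 H2 H3; split; last by rewrite Elast'.
  - by move=> y yp; rewrite all_rcons El// H1.
  - by move=> y yp; rewrite all_rcons Eu// H2.
rewrite /= up; case: ifPn => [/andP[ly yh]|nup].
- rewrite /= /corange_box_area adj; congr cons.
  apply: (IH (rcons pre p)) => //; apply: step => [y yp|y yp|].
  + rewrite yh /=; case: (ltP p.2 y) => //= py; exact: lt_trans ly py.
  + by rewrite (lt_gtF yh).
  + by rewrite (lt_gtF yh).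
- case: ifPn => [/andP[hy yu]|nlow].
  + apply: (IH (rcons pre p)) => //; apply: step => [y yp|y yp|].
    * by rewrite (lt_gtF hy).
    * rewrite hy /=; case: (ltP y p.2) => //= yp'; exact: lt_trans yp' yu.
    * by rewrite hy yu.
  + apply: (IH (rcons pre p)) => //; apply: step => [y yp|y yp|].
    * case: (ltP p.2 h) nup => //= yh; rewrite andbT -leNgt => yl.
      by case: (ltP l y) => ly; rewrite ?andbF// (le_lt_trans yl ly).
    * case: (ltP h p.2) nlow => //= hy; rewrite -leNgt => uy.
      by case: (ltP y u) => yu; rewrite ?andbF// (lt_le_trans yu uy).
    * by rewrite (negbTE nlow).
Qed.

(** The default 0 of [nth] is the value of the area when there are too few upper records; the index
    shifts by one because index 0 of [Xseq] holds the initial state [t]. *)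
Lemma Xseq_areas h s n : 0 < h < 1 -> uniq [seq p.1 | p <- s] ->
  all (fun p => 0 < p.2 < 1) s ->
  Xseq t h s n.+1 = nth 0 (areas h 0 1 (isort s)) n.
Proof.
move=> h01 us ys; have pe : perm_eq s (isort s) by rewrite perm_sym perm_isort.
rewrite (Xseq_perm _ _ _ _ pe us).
have ws := isort_sorted s us.
rewrite -areas_upper_records//; last by rewrite (perm_all _ (perm_isort s)).
rewrite /=; move: (upper_records h (isort s)).
by elim: n => [|n IH] [|a r] //=; exact: IH.
Qed.

End Emissions.

(** * Conditioning on the first atom *)

Section FirstAtom.
Context {R : realType}.
Variable t : R.
Notation P := (R * R)%type.
Local Open Scope ereal_scope.
Implicit Types (B : nat -> set R) (h l u : R) (n k : nat).

Lemma Jord_indic k x0 (A : set R) a G :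
  Jord t k x0 (fun s => (\1_A a)%:E * G s) = (\1_A a)%:E * Jord t k x0 G.
Proof.
rewrite indicE; case: (a \in A) => /=.
  by rewrite mul1e; apply: Jord_ext => s; rewrite mul1e.
rewrite mul0e; elim: k x0 G => [|k IH] x0 G /=; first by rewrite mul0e.
by rewrite -[RHS]lint20; apply: lint2_ext => p; case: ifP => // _; exact: IH.
Qed.

Definition W n B h l u (s : seq P) : \bar R :=
  (\prod_(i < n) \1_(B i) (nth 0 (areas t h l u s) i))%:E.

Lemma W_ge0 n B h l u s : 0 <= W n B h l u s.
Proof. by rewrite lee_fin; apply: prodr_ge0 => i _; rewrite indicE ler0n. Qed.

Lemma W_cons n B h l u p s : W n B h l u (p :: s) =
  if (l < p.2 < h)%R then
    if n is n'.+1 then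
      (\1_(B 0%N) ((t - p.1) * (u - p.2))%R)%:E * W n' (fun i => B i.+1) h p.2 u s
    else W 0 B h p.2 u s
  else if (h < p.2 < u)%R then W n B h l p.2 s else W n B h l u s.
Proof.
rewrite /W /=; case: ifP => _; last by case: ifP.
by case: n => [|n]; rewrite ?big_ord0// big_ord_recl EFinM.
Qed.

Lemma mseq_W n B : (forall i, measurable (B i)) ->
  mseq (fun (z : R * R * R) s => W n B z.1.1 z.1.2 z.2 s).
Proof.
move=> mB d' S a ps ma mps.
elim: mps n B mB a ma => [|p qs mp mqs IH] n B mB a ma; first by rewrite /W /=; mf.
rewrite /=; under eq_fun do rewrite W_cons.
have IH' n' B' (f1 f2 f3 : S -> R) : (forall i, measurable (B' i)) ->
    measurable_fun setT f1 -> measurable_fun setT f2 -> measurable_fun setT f3 ->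
    measurable_fun setT (fun w => W n' B' (f1 w) (f2 w) (f3 w) [seq p w | p <- qs]).
  by move=> mB' m1 m2 m3; apply: (IH _ _ mB' (fun w => (f1 w, f2 w, f3 w))); mf.
apply: mf_if; first by mf.
- case: n => [|n]; first by apply: IH' => //; mf.
  by apply: mf_mule; [mf; exact: mB|apply: IH' => //; mf].
- by apply: mf_if; [mf|apply: IH' => //; mf..].
Qed.

(* Averaging over [h] is what makes the evolution of the band ]l, u[ Markovian. *)
Definition V k n B x0 l u : \bar R :=
  lint (fun h => if (l < h < u)%R then Jord t k x0 (W n B h l u) else 0).

Lemma V_ge0 k n B x0 l u : 0 <= V k n B x0 l u.
Proof. by apply: lint_ge0 => h; case: ifP => // _; apply: Jord_ge0 => s; exact: W_ge0. Qed.

Lemma mf_Jord_W k n B {d} {T : measurableType d} (fx fh fl fu : T -> R) :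
  (forall i, measurable (B i)) ->
  measurable_fun setT fx -> measurable_fun setT fh ->
  measurable_fun setT fl -> measurable_fun setT fu ->
  measurable_fun setT (fun z => Jord t k (fx z) (W n B (fh z) (fl z) (fu z))).
Proof.
move=> mB mx mh ml mu.
apply: (mf_Jord t k (fun z s => W n B (fh z) (fl z) (fu z) s)) => //.
  by move=> z s; exact: W_ge0.
by apply: (mseq_comp _ (fun z => (fh z, fl z, fu z)) _ (mseq_W _ _ mB)); mf.
Qed.

Lemma mf_V k n B {d} {T : measurableType d} (fx fl fu : T -> R) :
  (forall i, measurable (B i)) -> measurable_fun setT fx ->
  measurable_fun setT fl -> measurable_fun setT fu ->
  measurable_fun setT (fun z => V k n B (fx z) (fl z) (fu z)).
Proof.
move=> mB mx ml mu.
apply: (mf_lint2 (fun z h => if (fl z < h < fu z)%R then Jord t k (fx z) (W n B h (fl z) (fu z)) else 0)).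
  by move=> z h; case: ifP => // _; apply: Jord_ge0 => s; exact: W_ge0.
have m1 (f : T -> R) : measurable_fun setT f -> measurable_fun setT (fun p : T * R => f p.1).
  by move=> mf; apply: (mf_comp f) => //; mf.
have mx' := m1 _ mx; have ml' := m1 _ ml; have mu' := m1 _ mu.
by apply: mf_if; [mf|apply: mf_Jord_W => //; mf|mf].
Qed.

(* What becomes of the band ]l, u[ at the first atom, which may fall outside. *)
Definition step (F : nat -> (nat -> set R) -> R -> R -> R -> \bar R) n B x0 l u :=
  lint2 (fun p => if inbox t x0 p then
    if (l < p.2 < u)%R then
      (if n is n'.+1 then
         (\1_(B 0%N) ((t - p.1) * (u - p.2))%R)%:E * F n' (fun i => B i.+1) p.1 p.2 u
       else F 0%N B p.1 p.2 u) + F n B p.1 l p.2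
    else F n B p.1 l u else 0).

Lemma V0 n B x0 l u : (l <= u)%R ->
  V 0 n B x0 l u = (u - l)%:E * (\prod_(i < n) \1_(B i) 0)%:E.
Proof.
move=> lu; rewrite -lint_itvoo// -lintZr; last 3 first.
- by rewrite lee_fin; apply: prodr_ge0 => i _; rewrite indicE ler0n.
- by move=> x; case: ifP.
- by mf.
apply: lint_ext => h /=; case: ifP => _; last by rewrite mul0e.
by rewrite mul1e /W; congr EFin; apply: eq_bigr => i _; rewrite nth_nil.
Qed.

(** The integral over [h] is moved inside the one over the first atom. An atom outside the band is
    no record for any [h] in the band; an atom inside cuts the range of [h] in two, and each half is
    again a range of integration of [V] for a smaller band. *)
Lemma VS k n B x0 l u : (forall i, measurable (B i)) ->
  V k.+1 n B x0 l u = step (V k) n B x0 l u.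
Proof.
move=> mB; rewrite /V /step.
pose F h p := if (l < h < u)%R && inbox t x0 p
  then Jord t k p.1 (fun s => W n B h l u (p :: s)) else 0.
have F0 h p : 0 <= F h p.
  by rewrite /F; case: ifP => // _; apply: Jord_ge0 => s; exact: W_ge0.
transitivity (lint (fun h => lint2 (F h))).
  apply: lint_ext => h; rewrite JordS -lint2_if; apply: lint2_ext => p.
  by rewrite /F; case: (l < h < u)%R.
rewrite (lint2_swap1 F)//; last first.
  apply: mf_if; [by apply: mf_and; [mf|apply: mf_inbox; mf]| |by mf].
  apply: (mf_Jord t k (fun (z : R * P) s => W n B z.1 l u (z.2 :: s))) => //.
  - by move=> z s; exact: W_ge0.
  - by apply: (mseq_comp _ (fun z : R * P => ((z.1, l, u), z.2)) _ (mseq_cons _ (mseq_W n B mB))); mf.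
  - by mf.
apply: lint2_ext => p; rewrite /F; case: (inbox t x0 p); last first.
  by under lint_ext do rewrite andbF; rewrite lint0.
under lint_ext do rewrite andbT.
case: ifPn => [/andP[lp pu]|np]; last first.
  apply: lint_ext => h; case: ifP => // /andP[lh hu]; apply: Jord_ext => s.
  rewrite W_cons; case: ifP => [/andP[lp ph]|_].
    by move: np; rewrite lp (lt_trans ph hu).
  case: ifP => // /andP[hp pu].
  by move: np; rewrite pu (lt_trans lh hp).
(* [F1] is the case of the line above the atom, an upper record that uses up one of the sets; [F2]
   is the case of the line below it, a lower record that emits nothing. *)
pose F1 h := if (p.2 < h < u)%R then (if n is n'.+1 then
    (\1_(B 0%N) ((t - p.1) * (u - p.2))%R)%:E * Jord t k p.1 (W n' (fun i => B i.+1) h p.2 u)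
  else Jord t k p.1 (W 0 B h p.2 u)) else 0.
pose F2 h := if (l < h < p.2)%R then Jord t k p.1 (W n B h l p.2) else 0.
have mB' i : measurable (B i.+1) by [].
have F10 h : 0 <= F1 h.
  rewrite /F1; case: ifP => // _; case: (n) => [|n'].
    by apply: Jord_ge0 => s; exact: W_ge0.
  by apply: mule_ge0; [nn|apply: Jord_ge0 => s; exact: W_ge0].
have F20 h : 0 <= F2 h.
  by rewrite /F2; case: ifP => // _; apply: Jord_ge0 => s; exact: W_ge0.
have mF1 : measurable_fun setT F1.
  rewrite /F1; apply: mf_if; [mf| |mf]; case: (n) => [|n'].
    by apply: mf_Jord_W => //; mf.
  by apply: mf_mule; [mf|apply: mf_Jord_W => //; mf].
have mF2 : measurable_fun setT F2.
  by rewrite /F2; apply: mf_if; [mf|apply: mf_Jord_W => //; mf|mf].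
transitivity (lint (fun h => F1 h + F2 h)).
  (* The line passing exactly through the atom is the only height missed by both cases. *)
  apply: (lint_eq_off [:: p.2]); first exact: mf_adde.
  move=> h; rewrite inE => hp.
  have [ph|ph] := ltP p.2 h.
  - have -> : F2 h = 0 by rewrite /F2 (lt_gtF ph) andbF.
    rewrite adde0 /F1 ph (lt_trans lp ph) /=.
    case: ifP => // hu; under Jord_ext do rewrite W_cons lp ph /=.
    by case: (n) => // n'; rewrite Jord_indic.
  - have {hp}ph : (h < p.2)%R by rewrite lt_neqAle hp.
    have -> : F1 h = 0 by rewrite /F1 (lt_gtF ph).
    rewrite add0e /F2 ph (lt_trans ph pu) !andbT; case: ifP => // lh.
    by under Jord_ext do rewrite W_cons (lt_gtF ph) andbF ph pu /=.
rewrite lintD//; congr (_ + _).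
rewrite /F1; case: (n) => // n'.
rewrite -lintZ; last 3 first.
- by nn.
- by move=> h; case: ifP => // _; apply: Jord_ge0 => s; exact: W_ge0.
- by apply: mf_if; [mf|apply: mf_Jord_W => //; mf|mf].
by apply: lint_ext => h; case: ifP => //; rewrite mule0.
Qed.

End FirstAtom.

(** * One step of the Q-process as an integral over coranges *)

Section QStep.
Context {R : realType}.
Local Open Scope ereal_scope.
Variable g : R -> \bar R.
Hypothesis g0 : forall z, 0 <= g z.
Hypothesis mg : measurable_fun setT g.

Ltac ms := repeat first
  [ mf_step
  | match goal with |- measurable_fun _ (fun w => lint _) =>
      apply: mf_lint2; [by nn|lazy beta] end
  | match goal with |- measurable_fun _ (fun w => g _) =>
      apply: (mf_comp g _ mg) end ].

Definition Qop (x : R) : \bar R :=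
  lint (fun e => if (0 <= e)%R then (expR (- e))%:E *
    lint (fun u1 => if (0 <= u1 <= 1)%R then
      lint (fun u2 => if (0 <= u2 <= 1)%R then g (qnext x e u1 u2) else 0) else 0) else 0).

(** Up to the factor [x^-1], the surviving part of a step of Q: integrating out [U2] gives
    [1 - e / x], the variable [(x - e) U1] has density [1 / (x - e)], and the product is the
    constant [1 / x] on ]0, x - e[. *)
Definition K (x : R) : \bar R :=
  lint (fun e => if (0 < e < x)%R then (expR (- e))%:E *
    lint (fun v => if (0 < v < x - e)%R then g v else 0) else 0).

(* In a box of length [s], the next upper record is reached at remaining length
   [r] with corange [w] with density [w * expR (- (s - r) * w)], whatever the
   height of the box, and no upper record is met with probability
   [expR (- s * w)] if the line is at height [w] above the bottom of the box.
   [phi] collects both contributions, scaled by [expR s]. *)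
Definition psi (r w : R) : \bar R := (expR r * w)%:E * g (r * w)%R.

Definition phi (s w : R) : \bar R :=
  (expR (s * (1 - w)))%:E * g 0%R +
  lint (fun r => if (0 < r < s)%R then (expR ((s - r) * (1 - w)))%:E * psi r w else 0).

(** The last term is absorption: given [U2 = u], it occurs when [E] is at least [x * u], with
    probability [expR (- (x * u))]. *)
Lemma Qop_split x : (0 < x)%R -> Qop x =
  (x^-1)%:E * K x +
  lint (fun u => if (0 < u < 1)%R then (expR (- (x * u)))%:E * g 0%R else 0).
Proof.
move=> x0.
pose F e := if (0 < e < x)%R then (expR (- e))%:E * ((x^-1)%:E *
  lint (fun v => if (0 < v < x - e)%R then g v else 0)) else 0.
pose H e u := if (0 <= e)%R && (0 < u < 1)%R && (x * u <= e)%R then (expR (- e))%:E * g 0%R else 0.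
have F0 e : 0 <= F e by rewrite /F; nn; rewrite invr_ge0 ltW.
have H0 e u : 0 <= H e u by rewrite /H; nn.
have mF : measurable_fun setT F by rewrite /F; ms.
have mH : measurable_fun setT (fun p : R * R => H p.1 p.2) by rewrite /H; ms.
have mH1 : measurable_fun setT (fun e => lint (H e)) by apply: mf_lint2.
transitivity (lint (fun e => F e + lint (H e))).
  apply: (lint_eq_off [:: 0%R]); first exact: mf_adde.
  move=> e; rewrite inE => e0.
  rewrite /F /H; have [ep|] := leP 0%R e; last first.
    by move=> /lt_gtF ->; rewrite add0e lint0.
  have {e0}ep : (0 < e)%R by rewrite lt_neqAle eq_sym e0.
  rewrite ep/=.
  (* For fixed [e], the uniform variable [U2] exceeds [e / x] with probability [1 - e / x], or never
     if [e >= x]. *)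
  have E1 (A D : \bar R) : 0 <= A -> 0 <= D ->
      lint (fun u2 => if (0 <= u2 <= 1)%R then (if (e < x * u2)%R then A else D) else 0)
      = (if (e < x)%R then (1 - e / x)%:E * A else 0)
        + lint (fun u2 => if (0 < u2 < 1)%R && (x * u2 <= e)%R then D else 0).
    move=> A0 D0.
    transitivity (lint (fun u2 => (if (e / x < u2 < 1)%R then 1 else 0) * A +
        (if (0 < u2 < 1)%R && (x * u2 <= e)%R then D else 0))).
      apply: (lint_eq_off [:: 0; 1]%R); first by ms.
      move=> u; rewrite !inE negb_or => /andP[u0 u1].
      rewrite !le_eqVlt eq_sym (negbTE u0) (negbTE u1)/= -[(_ == _) || _]le_eqVlt.
      rewrite (ltr_pdivrMr _ _ x0) (mulrC u) [in RHS]leNgt.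
      case: (ltP 0%R u) => up /=; last first.
        rewrite (_ : (e < x * u)%R = false) ?mul0e ?add0e//; apply/negbTE.
        by rewrite -leNgt (le_trans _ (ltW ep))// mulr_ge0_le0// ltW.
      by case: (u < 1)%R; case: (e < x * u)%R; rewrite /= ?mul1e ?mul0e ?add0e ?adde0.
    rewrite lintD; [|by nn|by nn|by ms|by ms]; congr (_ + _).
    rewrite lintZr; [|by nn|by nn|by ms].
    have [ex|xe] := ltP e x.
      by rewrite lint_itvoo// ler_pdivrMr// mul1r ltW.
    rewrite (_ : (fun _ => _) = fun=> 0) ?lint0 ?mul0e//; apply/funext => u.
    case: ifP => // /andP[]; rewrite ltr_pdivrMr// => eu u1.
    have ux : (u * x < x)%R by rewrite gtr_pMl.
    by have := lt_le_trans (lt_trans eu ux) xe; rewrite ltxx.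
  pose D := lint (fun u2 => if (0 < u2 < 1)%R && (x * u2 <= e)%R then g 0%R else 0).
  have D0 : 0 <= D by rewrite /D; nn.
  transitivity ((expR (- e))%:E * lint (fun u1 => (if (0 <= u1 <= 1)%R then
      (if (e < x)%R then (1 - e / x)%:E * g ((x - e) * u1)%R else 0) else 0) +
      (if (0 <= u1 <= 1)%R then 1 else 0) * D)).
    congr (_ * _); apply: lint_ext => u1; case: ifP => _; last by rewrite mul0e adde0.
    rewrite mul1e /D -(E1 (g ((x - e) * u1)%R) (g 0%R))//; apply: lint_ext => u2.
    by rewrite /qnext; case: (e < x * u2)%R.
  have ex1 : (e < x)%R -> (0 <= 1 - e / x)%R.
    by move=> ex; rewrite subr_ge0 ler_pdivrMr// mul1r ltW.
  rewrite lintD; last 4 first.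
  - have [ex|_] := ltP e x; last by nn.
    by have ex' := ex1 ex; nn.
  - by nn.
  - by case: (e < x)%R; ms.
  - by ms.
  rewrite lintZr; [|by nn|by nn|by ms].
  rewrite lint_unit mul1e ge0_muleDr//; last first.
    have [ex|_] := ltP e x; last by nn.
    by have ex' := ex1 ex; nn.
  congr (_ + _); last first.
    rewrite /D -lintZ; [|by nn|by nn|by ms].
    by apply: lint_ext => u2; case: ifP => //; rewrite mule0.
  have [ex|_] := ltP e x; last first.
    by under lint_ext do rewrite if_same; rewrite lint0 mule0.
  congr (_ * _).
  have xe : (0 < x - e)%R by rewrite subr_gt0.
  (* Substitution [v = (x - e) * u1]; its Jacobian turns [x^-1] into [1 - e / x]. *)
  rewrite -(@lint_affine_gt0 _ (x - e) 0 (fun v => if (0 < v < x - e)%R then g v else 0))//; [|by nn|by ms].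
  rewrite muleA -EFinM (_ : x^-1 * (x - e) = 1 - e / x)%R; last by field; rewrite gt_eqF.
  rewrite -lintZ; last 3 first.
  - by rewrite lee_fin subr_ge0 ler_pdivrMr// mul1r ltW.
  - by nn.
  - by ms.
  apply: (lint_eq_off [:: 0; 1]%R); first by ms.
  move=> u; rewrite !inE negb_or => /andP[u0 u1].
  rewrite addr0 pmulr_rgt0// gtr_pMr// !le_eqVlt eq_sym (negbTE u0) (negbTE u1)/=.
  by case: ifP => // _; rewrite mule0.
rewrite lintD//; last by move=> e; exact: lint_ge0.
congr (_ + _).
  rewrite /K -lintZ; [|by rewrite lee_fin invr_ge0 ltW|by nn|by ms].
  by apply: lint_ext => e; rewrite /F; case: ifP => _; [rewrite muleCA|rewrite mule0].
rewrite (lint_swap H)//; apply: lint_ext => u; rewrite /H.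
case: (boolP (0 < u < 1)%R) => [/andP[u0 u1]|_]; last first.
  by under lint_ext do rewrite andbF /=; rewrite lint0.
rewrite -lint_expN_tail -lintZr; [|by nn|by nn|by ms].
apply: lint_ext => e; rewrite andbT.
case: (leP (x * u)%R e) => [xue|_]; last by rewrite andbF mul0e.
by rewrite (le_trans _ xue)// mulr_ge0// ltW.
Qed.

Lemma psi_ge0 r w : (0 <= w)%R -> 0 <= psi r w.
Proof. by move=> w0; rewrite /psi; nn. Qed.

(* Change of variables (r, w) |-> (e, v) = ((s - r) w, r w). *)
Lemma lint_psi s c : (0 < s)%R -> (0 < c)%R ->
  lint (fun w => if (0 < w < c)%R then
    lint (fun r => if (0 < r < s)%R then (expR ((s - r) * (1 - w)))%:E * psi r w else 0)
    else 0) = (expR s * s^-1)%:E * K (s * c).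
Proof.
move=> s0 c0.
pose f w e := if (0 < e < w)%R then (expR (- e))%:E * g (w - e)%R else 0.
have f0 w e : 0 <= f w e by rewrite /f; nn.
have mf : measurable_fun setT (fun p : R * R => f p.1 p.2) by rewrite /f; ms.
have mf1 w : measurable_fun setT (f w) by rewrite /f; ms.
pose F z := if (0 < z < s * c)%R then lint (f z) else 0.
have mfL : measurable_fun setT (fun z => lint (f z)) by apply: mf_lint2.
have F0 z : 0 <= F z by rewrite /F; nn.
have mF : measurable_fun setT F by rewrite /F; ms.
transitivity (lint (fun w => (expR s)%:E * F (s * w + 0)%R)).
  apply: lint_ext => w; rewrite addr0 /F pmulr_rgt0// ltr_pM2l//.
  case: ifP => [/andP[w0 wc]|]; last by rewrite mule0.
  (* Substitution [e = (s - r) * w], whose Jacobian is the factor [w] of [psi]; since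
     [r * w = s * w - e], the new state is the old one at corange [w] minus [e]. *)
  rewrite -(@lint_affine _ (- w) (s * w) (f (s * w)%R))//; last by rewrite oppr_eq0 gt_eqF.
  rewrite normrN gtr0_norm// muleA -EFinM -lintZ; [|by nn; exact: ltW| |]; last 2 first.
  - by move=> x; exact: f0.
  - by apply: (mf_comp (f (s * w)%R)) => //; ms.
  apply: lint_ext => r; rewrite /f (_ : - w * r + s * w = (s - r) * w)%R; last by ring.
  rewrite pmulr_lgt0// subr_gt0 ltr_pM2r// ltrBlDl ltrDr andbC.
  case: ifP => [/andP[rs r0]|]; last by rewrite mule0.
  rewrite /psi (_ : s * w - (s - r) * w = r * w)%R; last by ring.
  rewrite !muleA -!EFinM; congr (_%:E * _).
  rewrite mulrA -expRD [RHS]mulrAC -expRD; congr (expR _ * w)%R; ring.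
rewrite lintZ; [|by nn| |]; last 2 first.
- by move=> w; exact: F0.
- by apply: (mf_comp F) => //; ms.
rewrite EFinM -muleA; congr (_ * _).
suff <- : lint F = K (s * c).
  by rewrite -(@lint_affine_gt0 _ s 0 F)// muleA -EFinM mulVf ?gt_eqF// mul1e.
transitivity (lint (fun z => lint (fun e => if (0 < z < s * c)%R then f z e else 0))).
  by apply: lint_ext => z; rewrite lint_if.
rewrite (lint_swap (fun z e => if (0 < z < s * c)%R then f z e else 0)); [|by nn|by ms].
apply: lint_ext => e; rewrite /f.
have [e0|e0] := ltP 0%R e; last first.
  rewrite /= (_ : (fun _ => _) = fun=> 0) ?lint0//; apply/funext => z.
  by rewrite if_same.
have [ex|xe] := ltP e (s * c)%R; last first.
  rewrite /= (_ : (fun _ => _) = fun=> 0) ?lint0//; apply/funext => z.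
  case: ifP => // /andP[_ zx]; case: ltP => // ez.
  by have := lt_trans (le_lt_trans xe ez) zx; rewrite ltxx.
rewrite -[in RHS](@lint_shift _ (- e))/=; [|by nn|by ms].
rewrite -lintZ; [|by nn|by nn|by ms].
apply: lint_ext => z; rewrite subr_gt0 ltrD2r.
case: (ltP e z) => [ez|_]; last by rewrite if_same mule0.
by rewrite (lt_trans e0 ez)/=; case: ifP => // _; rewrite mule0.
Qed.

(** The width [c] survives only as the range of [w]. A step of Q from [s * c] thus splits linearly
    over coranges, which makes bands of different widths comparable. *)
Lemma Qop_phi s c : (0 < s)%R -> (0 < c)%R ->
  (expR s * c)%:E * Qop (s * c) = lint (fun w => if (0 < w < c)%R then phi s w else 0).
Proof.
move=> s0 c0; rewrite Qop_split ?mulr_gt0// ge0_muleDr; last 2 first.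
- by apply: mule_ge0; [rewrite lee_fin invr_ge0 mulr_ge0 ?ltW|rewrite /K; nn].
- by nn.
transitivity (lint (fun w => (if (0 < w < c)%R then (expR (s * (1 - w)))%:E * g 0%R else 0) +
    (if (0 < w < c)%R then
    lint (fun r => if (0 < r < s)%R then (expR ((s - r) * (1 - w)))%:E * psi r w else 0)
    else 0))); last first.
  by apply: lint_ext => w; rewrite /phi; case: ifP; rewrite ?adde0.
rewrite lintD; last 4 first.
- by nn.
- move=> w; case: ifP => // /andP[w0 _]; rewrite /psi; nn; exact: ltW.
- by ms.
- under eq_fun do rewrite -lint_if; apply: mf_lint2 => [w r|]; last by rewrite /psi; ms.
  by case: ifP => // /andP[w0 _]; rewrite /psi; nn; exact: ltW.
rewrite addeC lint_psi//; congr (_ + _).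
  pose f w := if (0 < w < c)%R then (expR (s * (1 - w)))%:E * g 0%R else 0.
  transitivity (c%:E * lint (fun u => f (c * u + 0)%R)); last first.
    by apply: lint_affine_gt0 => //; rewrite /f; [nn|ms].
  rewrite EFinM [in LHS]muleC muleA [in LHS]muleC; congr (_ * _).
  rewrite muleC -lintZ; [|by nn|by nn|by ms].
  apply: lint_ext => u; rewrite /f addr0 pmulr_rgt0// gtr_pMr//.
  case: ifP => _; last by rewrite mule0.
  rewrite muleA -EFinM -expRD; congr ((expR _)%:E * _); ring.
rewrite muleA -EFinM; congr (_%:E * _); field.
by rewrite !gt_eqF.
Qed.

Lemma expR_sub1_ge0 (y : R) : (0 <= y)%R -> (0 <= expR y - 1)%R.
Proof. by move=> y0; rewrite subr_ge0 -[X in (X <= _)%R]expR0 ler_expR. Qed.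

(** [phi] is the variation-of-constants solution of the linear equation with derivative
    [(1 - w) * phi + psi] in [s] and initial value [g 0]; this is its integrated form, obtained by
    exchanging integrals instead of differentiating. *)
Lemma phi_ode s w : (0 <= s)%R -> (0 < w < 1)%R ->
  phi s w = g 0%R + lint (fun r => if (0 < r < s)%R then
    (1 - w)%:E * phi r w + psi r w else 0).
Proof.
move=> s0 /andP[w0 w1].
have a0 : (0 <= 1 - w)%R by rewrite subr_ge0 ltW.
have p0 r : 0 <= psi r w by apply: psi_ge0; exact: ltW.
have mp : measurable_fun setT (fun r => psi r w) by rewrite /psi; ms.
pose f r q := if (0 < q < r)%R && (r < s)%R then
  ((1 - w) * expR ((r - q) * (1 - w)))%:E * psi q w else 0.
have mf : measurable_fun setT (fun p : R * R => f p.1 p.2).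
  by rewrite /f /psi; ms.
have f0 r q : 0 <= f r q by rewrite /f; case: ifP => // _; have := p0 q; nn.
have mf1 r : measurable_fun setT (f r) by rewrite /f /psi; ms.
transitivity (g 0%R + lint (fun r =>
    (if (0 < r < s)%R then ((1 - w) * expR ((r - 0) * (1 - w)))%:E else 0) * g 0%R
    + lint (f r) + (if (0 < r < s)%R then psi r w else 0))); last first.
  congr (_ + _); apply: lint_ext => r; rewrite /f.
  have [r0|r0] := ltP 0%R r; last first.
    rewrite /= mul0e adde0 add0e (_ : (fun _ => _) = fun=> 0) ?lint0//.
    apply/funext => q; case: (ltP 0%R q) => //= q0.
    by rewrite ltNge (le_trans r0 (ltW q0)).
  have [rs|sr] := ltP r s; last first.
    rewrite /= mul0e adde0 add0e (_ : (fun _ => _) = fun=> 0) ?lint0//.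
    by apply/funext => q; rewrite andbF.
  rewrite /=; congr (_ + _); rewrite /phi subr0 ge0_muleDr; last 2 first.
  - by nn.
  - by apply: lint_ge0 => q; case: ifP => // _; have := p0 q; nn.
  rewrite EFinM muleA -lintZ; last 3 first.
  - by nn.
  - by move=> q; case: ifP => // _; have := p0 q; nn.
  - by ms.
  congr (_ + _); apply: lint_ext => q; rewrite andbT; case: ifP => _; last by rewrite mule0.
  by rewrite [RHS]muleA -EFinM.
have i0 r : 0 <= (if (0 < r < s)%R then ((1 - w) * expR ((r - 0) * (1 - w)))%:E else 0) * g 0%R by nn.
have mL : measurable_fun setT (fun r => lint (f r)) by apply: mf_lint2.
rewrite lintD; last 4 first.
- by move=> r; apply: adde_ge0 => //; exact: lint_ge0.
- by move=> r; case: ifP.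
- by apply: mf_adde => //; ms.
- by ms.
rewrite lintD//; last 2 first.
- by move=> r; exact: lint_ge0.
- by ms.
rewrite lintZr; [|by nn|by nn|by ms].
rewrite lint_expR// subr0 (lint_swap f)//.
rewrite /phi -[X in _ = _ + X]addeA [RHS]addeA; congr (_ + _).
  rewrite -[X in _ = X + _]mul1e -ge0_muleDl//; last first.
    by rewrite lee_fin expR_sub1_ge0// mulr_ge0.
  by rewrite -EFinD addrCA subrr addr0.
rewrite -lintD; last 4 first.
- by move=> q; exact: lint_ge0.
- by move=> r; case: ifP.
- by apply: (mf_lint2 (fun q r => f r q)) => //; rewrite /f /psi; ms.
- by ms.
apply: lint_ext => q; rewrite /f.
have [q0|q0] := ltP 0%R q; last by rewrite /= adde0 lint0.
have [qs|sq] := ltP q s; last first.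
  rewrite /= adde0 (_ : (fun _ => _) = fun=> 0) ?lint0//.
  apply/funext => r; case: (ltP q r) => //= qr.
  by rewrite ltNge (le_trans sq (ltW qr)).
(* Integrating over [r] in ]q, s[ gives [expR ((s - q) * (1 - w)) - 1]; the separate [psi] term
   supplies the missing 1. *)
rewrite /= -[X in _ + X]mul1e.
transitivity (lint (fun r => (if (q < r < s)%R then
   ((1 - w) * expR ((r - q) * (1 - w)))%:E else 0) * psi q w) + 1 * psi q w); last first.
  congr (_ + _); apply: lint_ext => r; case: ifP => //; rewrite mul0e//.
rewrite lintZr//; [|by nn|by ms].
rewrite (lint_expR _ _ _ (ltW qs)) -ge0_muleDl//.
  by rewrite -EFinD subrK.
by rewrite lee_fin expR_sub1_ge0// mulr_ge0// subr_ge0 ltW.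
Qed.

End QStep.

(** * Averaging over the height of the first atom *)

Section Band.
Context {R : realType}.
Local Open Scope ereal_scope.
Variable g : R -> \bar R.
Hypothesis g0 : forall z, 0 <= g z.
Hypothesis mg : measurable_fun setT g.

Lemma phi_ge0 s w : (0 <= w)%R -> 0 <= phi g s w.
Proof.
by move=> w0; rewrite /phi; nn; apply: psi_ge0.
Qed.

Lemma mf_psi {d} {T : measurableType d} (fr fw : T -> R) :
  measurable_fun setT fr -> measurable_fun setT fw ->
  measurable_fun setT (fun z => psi g (fr z) (fw z)).
Proof. by move=> mr mw; rewrite /psi; mf; apply: (mf_comp g _ mg); mf. Qed.

(** The guard [b] keeps [w] nonnegative, where the integrand defining [phi] is nonnegative as the
    measurability of parametric integrals demands. *)
Lemma mf_phi {d} {T : measurableType d} (b : T -> bool) (fr fw : T -> R) :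
  measurable_fun setT fr -> measurable_fun setT fw ->
  measurable_fun setT b -> (forall z, b z -> (0 <= fw z)%R) ->
  measurable_fun setT (fun z => if b z then phi g (fr z) (fw z) else 0).
Proof.
move=> mr mw mb bw.
have m1 d' (T' : measurableType d') (f : T -> T') : measurable_fun setT f -> measurable_fun setT (fun p : T * R => f p.1).
  by move=> mf; apply: (mf_comp f) => //; mf.
have := m1 _ _ _ mb; have := m1 _ _ _ mr; have := m1 _ _ _ mw => mw' mr' mb'.
rewrite [X in measurable_fun _ X](_ : _ = fun z =>
  (if b z then (expR (fr z * (1 - fw z)))%:E * g 0%R else 0) +
  lint (fun r => if b z && (0 < r < fr z)%R then (expR ((fr z - r) * (1 - fw z)))%:E * psi g r (fw z) else 0)).
  apply: mf_adde; first by mf.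
  apply: mf_lint2 => [z r|].
    by case: ifP => // /andP[bz _]; have := psi_ge0 g g0 r (fw z) (bw z bz); nn.
  by mf; apply: mf_psi; mf.
apply/funext => z; rewrite /phi; case: (b z) => /=; last by rewrite lint0 adde0.
by [].
Qed.

Lemma lint_band r l u : (0 <= l)%R -> (l < u)%R -> (u <= 1)%R ->
  let C c := lint (fun w => if (0 < w < c)%R then phi g r w else 0) in
  lint (fun y => if (0 < y < 1)%R then
      if (l < y < u)%R then psi g r (u - y) + C (y - l)%R else C (u - l)%R
    else 0)
  = lint (fun w => if (0 < w < u - l)%R then (1 - w)%:E * phi g r w + psi g r w else 0).
Proof.
move=> l0 lu u1 C; set c := (u - l)%R.
have c0 : (0 < c)%R by rewrite subr_gt0.
have phi0 w : 0 <= (if (0 < w < c)%R then phi g r w else 0).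
  by case: ifP => // /andP[/ltW w0 _]; exact: phi_ge0.
have C0 a : 0 <= C a.
  by apply: lint_ge0 => w; case: ifP => // /andP[/ltW w0 _]; exact: phi_ge0.
have psi0 (w : R) (b : bool) : 0 <= (if (0 < w)%R && b then psi g r w else 0).
  by case: ifP => // /andP[/ltW w0 _]; exact: psi_ge0.
have mC : measurable_fun setT C.
  apply: (mf_lint2 (fun a w => if (0 < w < a)%R then phi g r w else 0)).
    by move=> a w; case: ifP => // /andP[/ltW w0 _]; exact: phi_ge0.
  by apply: mf_phi; [mf|mf|mf|move=> z /andP[/ltW]].
have mphi : measurable_fun setT (fun w : R => if (0 < w < c)%R then phi g r w else 0).
  by apply: (mf_phi (fun w : R => (0 < w < c)%R) (fun=> r) id); [mf|mf|mf|move=> z /andP[/ltW]].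
pose f1 w := if (0 < w < c)%R then psi g r w else 0.
pose f2 w := if (0 < w < c)%R then C w else 0.
pose f3 y : \bar R := (if (0 < y < l)%R then 1 else 0) + (if (u < y < 1)%R then 1 else 0).
have f10 w : 0 <= f1 w by exact: psi0.
have f20 w : 0 <= f2 w by rewrite /f2; nn.
have f30 w : 0 <= f3 w by rewrite /f3; nn.
have mf1 : measurable_fun setT f1 by rewrite /f1; mf; apply: mf_psi; mf.
have mf2 : measurable_fun setT f2 by rewrite /f2; mf.
have mf3 : measurable_fun setT f3 by rewrite /f3; mf.
have mf1' : measurable_fun setT (fun y : R => f1 (u - y)%R) by apply: (mf_comp f1) => //; mf.
have mf2' : measurable_fun setT (fun y : R => f2 (y - l)%R) by apply: (mf_comp f2) => //; mf.
transitivity (lint (fun y => f1 (u - y)%R + f2 (y - l)%R + f3 y * C c)).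
  apply: (lint_eq_off [:: l; u]); first by mf.
  move=> y; rewrite !inE negb_or => /andP[yl yu].
  rewrite /f1 /f2 /f3 !subr_gt0 ltrD2r ltrD2l ltrN2.
  have [yl'|ly] := ltP y l.
    have yu' := lt_trans yl' lu.
    rewrite (lt_le_trans yu' u1) (lt_gtF yl') /= andbF.
    by rewrite (lt_gtF yu') !andbT /= !add0e !adde0; case: ifP; rewrite ?mul1e ?mul0e.
  have {ly}ly : (l < y)%R by rewrite lt_neqAle eq_sym yl.
  have y0 := le_lt_trans l0 ly.
  rewrite y0 ly /=; have [yu'|uy] := ltP y u.
    by rewrite (lt_le_trans yu' u1) (lt_gtF yu')/= add0e mul0e adde0.
  have {uy}uy : (u < y)%R by rewrite lt_neqAle eq_sym yu.
  by rewrite uy /= !add0e; case: ifP; rewrite ?mul1e ?mul0e.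
rewrite lintD; [|by move=> y; exact: adde_ge0|by nn|exact: mf_adde|by mf].
rewrite lintD//.
rewrite (lint_refl u f1)// (lint_shift (- l) f2)// lintZr//.
rewrite lintD//; [|by nn|by nn|by mf|by mf].
rewrite !lint_itvoo// subr0.
(* Exchanging the two integrals, [phi g r v] is counted once for each [w] in ]v, c[. *)
have E2 : lint f2 = lint (fun v => (c - v)%:E * (if (0 < v < c)%R then phi g r v else 0)).
  pose h w v := if (0 < v < w)%R && (w < c)%R then phi g r v else 0.
  have h0 w v : 0 <= h w v.
    by rewrite /h; case: ifP => // /andP[/andP[/ltW v0 _] _]; exact: phi_ge0.
  have mh : measurable_fun setT (fun p : R * R => h p.1 p.2).
    by apply: mf_phi; [mf|mf|mf|move=> z /andP[/andP[/ltW]]].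
  transitivity (lint (fun w => lint (h w))).
    apply: lint_ext => w; rewrite /f2 /C /h; case: (ltP 0%R w) => [w0|w0] /=.
      by case: (ltP w c) => _; under [RHS]lint_ext do rewrite ?andbT ?andbF//=; rewrite ?lint0.
    rewrite (_ : (fun _ => _) = fun=> 0) ?lint0//; apply/funext => v.
    by case: (ltP 0%R v) => //= v0; rewrite ltNge (ltW (le_lt_trans w0 v0)).
  rewrite (lint_swap h)//; apply: lint_ext => v; rewrite /h.
  have [v0|v0] := ltP 0%R v; last by rewrite /= lint0 mule0.
  have [vc|cv] := ltP v c; last first.
    rewrite /= mule0 (_ : (fun _ => _) = fun=> 0) ?lint0//; apply/funext => w.
    by case: (ltP v w) => //= vw; rewrite ltNge (le_trans cv (ltW vw)).
  rewrite /= -lint_itvoo; last exact: ltW.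
  rewrite -lintZr; [|exact/phi_ge0/ltW|by nn|by mf].
  by apply: lint_ext => w; case: ifP; rewrite ?mul1e ?mul0e.
have mcphi : measurable_fun setT (fun v : R => (c - v)%:E * (if (0 < v < c)%R then phi g r v else 0)).
  by apply: mf_mule => //; mf.
have cphi0 v : 0 <= (c - v)%:E * (if (0 < v < c)%R then phi g r v else 0).
  case: ifP => [/andP[v0 vc]|]; last by rewrite mule0.
  by apply: mule_ge0; [rewrite lee_fin subr_ge0 ltW|exact/phi_ge0/ltW].
have lu0 : (0 <= l + (1 - u))%R by rewrite addr_ge0// subr_ge0.
rewrite E2 -EFinD muleC /C -lintZr// -lintD// -lintD; last 4 first.
- by move=> v; exact: adde_ge0.
- by move=> v; exact: mule_ge0.
- exact: mf_adde.
- by mf.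
apply: lint_ext => v; rewrite /f1; case: ifP => [/andP[v0 vc]|_]; last by rewrite !mule0 mul0e !adde0.
rewrite [RHS]addeC -addeA; congr (_ + _).
rewrite [X in _ + X]muleC -ge0_muleDl ?lee_fin//; last by rewrite subr_ge0 ltW.
by rewrite -EFinD; congr (_%:E * _); rewrite /c; ring.
Qed.

End Band.

(** * Finite-dimensional distributions of the Q-process and the integral equation *)

Section QFdd.
Context {R : realType}.
Local Open Scope ereal_scope.
Implicit Types (B : nat -> set R) (n : nat) (x : R).

Definition gq n B (z : R) : \bar R :=
  (\1_(B 0%N) z)%:E * qfdd n (fun i => B i.+1) z.

Lemma qfddS n B x : qfdd n.+1 B x = Qop (gq n B) x.
Proof.
rewrite /= (lint_bool (fun e => 0 <= e)%R); apply: lint_ext => e.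
case: ifP => // _; congr (_ * _).
rewrite (lint_bool (fun u => 0 <= u <= 1)%R); apply: lint_ext => u1.
by case: ifP => // _; rewrite (lint_bool (fun u => 0 <= u <= 1)%R).
Qed.

Lemma qfdd_ge0 n B x : 0 <= qfdd n B x.
Proof.
elim: n B x => [|n IH] B x; first by rewrite /= lee_fin.
by rewrite qfddS /Qop /gq; nn.
Qed.

Lemma gq_ge0 n B x : 0 <= gq n B x.
Proof. by apply: mule_ge0; [rewrite lee_fin indicE|exact: qfdd_ge0]. Qed.

Lemma mf_Qop (g : R -> \bar R) : (forall z, 0 <= g z) -> measurable_fun setT g ->
  measurable_fun setT (Qop g).
Proof.
move=> g0 mg; apply: mf_lint2 => [x e|]; first by nn.
apply: mf_if; [by mf| |by mf].
apply: mf_mule; first by mf.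
apply: mf_lint2 => [x e|]; first by nn.
apply: mf_if; [by mf| |by mf].
apply: mf_lint2 => [x e|]; first by nn.
apply: mf_if; [by mf| |by mf].
by rewrite /qnext; apply: (mf_comp g _ mg); mf.
Qed.

Lemma mf_qfdd n B : (forall i, measurable (B i)) -> measurable_fun setT (@qfdd R n B).
Proof.
elim: n B => [|n IH] B mB; first exact: measurable_cst.
rewrite (_ : qfdd n.+1 B = Qop (gq n B)); last by apply/funext => x; exact: qfddS.
apply: mf_Qop => [z|]; first exact: gq_ge0.
by rewrite /gq; apply: mf_mule; [mf; exact: mB|exact: IH].
Qed.

Lemma mf_gq n B : (forall i, measurable (B i)) -> measurable_fun setT (gq n B).
Proof.
by move=> mB; rewrite /gq; apply: mf_mule; [mf; exact: mB|exact: mf_qfdd].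
Qed.

Lemma lint_unit_cst (D : \bar R) : 0 <= D ->
  lint (fun u : R => if (0 <= u <= 1)%R then D else 0) = D.
Proof.
move=> D0; rewrite -[RHS]mul1e -lint_unit -lintZr; [|by []|by nn|by mf].
by apply: lint_ext => u; case: ifP; rewrite ?mul1e ?mul0e.
Qed.

Lemma lint_exp_cst (D : \bar R) : 0 <= D ->
  lint (fun e : R => if (0 <= e)%R then (expR (- e))%:E * D else 0) = D.
Proof.
move=> D0; have := lint_expN_tail (0 : R); rewrite oppr0 expR0 => E1.
rewrite -[RHS]mul1e -E1 -lintZr; [|by []|by nn|by mf].
by apply: lint_ext => e; case: ifP; rewrite ?mul0e.
Qed.

Lemma Qop_le1 (g : R -> \bar R) x : (forall z, 0 <= g z) -> measurable_fun setT g ->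
  (forall z, g z <= 1) -> Qop g x <= 1.
Proof.
move=> g0 mg g1; rewrite -[leRHS](@lint_exp_cst 1)//.
have m3 : measurable_fun setT (fun p : R * R * R => g (qnext x p.1.1 p.1.2 p.2)).
  by rewrite /qnext; apply: (mf_comp g _ mg); mf.
have m2 : measurable_fun setT (fun p : R * R =>
   lint (fun u2 => if (0 <= u2 <= 1)%R then g (qnext x p.1 p.2 u2) else 0)).
  by apply: mf_lint2 => [p u|]; [nn|mf].
have m1 : measurable_fun setT (fun e : R => lint (fun u1 => if (0 <= u1 <= 1)%R then
   lint (fun u2 => if (0 <= u2 <= 1)%R then g (qnext x e u1 u2) else 0) else 0)).
  by apply: mf_lint2 => [p u|]; [nn|mf].
apply: lint_le => [e|||e]; [by nn|by mf|by mf|].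
case: ifP => // _; rewrite lee_pmul2l ?lte_fin ?expR_gt0//.
rewrite -[leRHS](@lint_unit_cst 1)//; apply: lint_le => [u||| u1]; [by nn| |by mf|].
  apply: mf_if; [by mf| |by mf].
  by apply: (mf_comp _ (fun u1 : R => (e, u1)) m2); mf.
case: ifP => // _; rewrite -[leRHS](@lint_unit_cst 1)//.
apply: lint_le => [u||| u2]; [by nn| |by mf|].
  apply: mf_if; [by mf| |by mf].
  by apply: (mf_comp _ (fun u2 : R => (e, u1, u2)) m3); mf.
by case: ifP.
Qed.

Lemma qfdd_le1 n B x : (forall i, measurable (B i)) -> qfdd n B x <= 1.
Proof.
elim: n B x => [|n IH] B x mB; first by rewrite /= lexx.
rewrite qfddS; apply: Qop_le1; [exact: gq_ge0|exact: mf_gq|move=> z].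
rewrite /gq indicE; case: (_ \in _); rewrite ?mul1e ?mul0e//.
by apply: IH.
Qed.

(** From 0 the condition [e < 0 * u2] fails for every [e >= 0], so 0 is absorbing. The same product
    is what [V] tests on a configuration without atoms. *)
Lemma qfdd_at0 n B : qfdd n B 0 = (\prod_(i < n) \1_(B i) (0 : R))%:E.
Proof.
elim: n B => [|n IH] B; first by rewrite big_ord0.
rewrite qfddS big_ord_recl EFinM; transitivity (gq n B 0); last by rewrite /gq IH.
rewrite -[RHS]lint_exp_cst; last exact: gq_ge0.
apply: lint_ext => e; case: ifP => // e0; congr (_ * _).
rewrite -[RHS]lint_unit_cst; last exact: gq_ge0.
apply: lint_ext => u1; case: ifP => // _.
rewrite -[RHS]lint_unit_cst; last exact: gq_ge0.
by apply: lint_ext => u2; rewrite /qnext mul0r ltNge e0.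
Qed.

Variable t : R.

(* The value of [V], summed over the number of atoms, that the theorem predicts;
   the absolute value only serves to make it nonnegative for [u < l]. *)
Definition Cq n B (x0 l u : R) : \bar R :=
  (expR (t - x0) * `|u - l|)%:E * qfdd n B ((t - x0) * (u - l))%R.

Lemma Cq_le n B x0 l u : (l <= u)%R ->
  Cq n B x0 l u = (expR (t - x0) * (u - l))%:E * qfdd n B ((t - x0) * (u - l))%R.
Proof. by move=> lu; rewrite /Cq ger0_norm// subr_ge0. Qed.

(** For positive [n], this is [phi_ode] integrated over [w] in ]0, u - l[: the term [g 0] becomes
    the contribution of no atom, and [lint_band] recognises the remaining integrand as [step]. *)
Lemma Cq_fix n B x0 l u : (forall i, measurable (B i)) ->
  (x0 < t)%R -> (0 <= l)%R -> (l < u)%R -> (u <= 1)%R ->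
  Cq n B x0 l u = V t 0 n B x0 l u + step t Cq n B x0 l u.
Proof.
move=> mB xt l0 lu u1; rewrite V0 ?ltW//; set c := (u - l)%R; set s := (t - x0)%R.
have c0 : (0 < c)%R by rewrite subr_gt0.
have s0 : (0 < s)%R by rewrite subr_gt0.
case: n => [|n].
  (* With no set left to test, no step of Q is available; the equation says that [c * expR s] is [c]
     plus the integral of [c * expR r] over ]0, s[. *)
  rewrite big_ord0 mule1 Cq_le ?ltW// /= mule1 -/c -/s.
  have -> : step t Cq 0 B x0 l u =
    lint (fun x => (if (x0 < x < t)%R then (1 * expR ((t - x - 0) * 1))%:E else 0) * c%:E).
    apply: lint_ext => x; rewrite /inbox /=; case: ifP => _; last by rewrite lint0 mul0e.
    transitivity (lint (fun y : R => (if (0 < y < 1)%R then 1 else 0) * (expR (t - x) * c)%:E)).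
      apply: lint_ext => y /=; case: (0 < y < 1)%R => /=; last by rewrite mul0e.
      rewrite mul1e; case: ifP => [/andP[ly yu]|_]; rewrite !Cq_le ?ltW//= !mule1//.
      by rewrite -EFinD -mulrDr; congr (_ * _)%:E; rewrite addrA subrK.
    rewrite lintZr; [|by nn; exact: ltW|by nn|by mf].
    by rewrite lint_itvoo// !subr0 mul1e mulr1 mul1r EFinM.
  rewrite lintZr; [|by rewrite lee_fin ltW|by nn|by mf].
  pose f r := (if (0 < r < s)%R then (1 * expR ((r - 0) * 1))%:E else 0).
  transitivity (c%:E + lint (fun x => f (t - x)%R) * c%:E).
    rewrite (lint_refl t f); [|by rewrite /f; nn|by rewrite /f; mf].
    rewrite lint_expR ?ltW// subr0 mulr1 -EFinM -EFinD; congr EFin; ring.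
  congr (_ + _ * _); apply: lint_ext => x; rewrite /f subr_gt0 ltrD2l ltrN2 andbC.
  by case: ifP => //; rewrite mul1r.
pose g := gq n B.
have g0 z : 0 <= g z by exact: gq_ge0.
have mg : measurable_fun setT g by exact: mf_gq.
have gE : g 0%R = (\prod_(i < n.+1) \1_(B i) 0)%:E.
  by rewrite /g /gq qfdd_at0 big_ord_recl EFinM.
have CqE x l' u' : (x < t)%R -> (l' < u')%R -> Cq n.+1 B x l' u' =
    lint (fun w => if (0 < w < u' - l')%R then phi g (t - x) w else 0).
  by move=> xt' lu'; rewrite Cq_le ?ltW// qfddS -Qop_phi// ?subr_gt0.
pose M r w := if (0 < r < s)%R && (0 < w < c)%R then (1 - w)%:E * phi g r w + psi g r w else 0.
have M0 r w : 0 <= M r w.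
  rewrite /M; case: ifP => // /and3P[_ w0 wc]; apply: adde_ge0.
    apply: mule_ge0; last exact/phi_ge0/ltW.
    by rewrite lee_fin subr_ge0 (le_trans (ltW wc))// lerBlDr ler_wpDr.
  exact/psi_ge0/ltW.
have mM : measurable_fun setT (fun p : R * R => M p.1 p.2).
  rewrite (_ : (fun _ => _) = fun p : R * R =>
    (1 - p.2)%:E * (if (0 < p.1 < s)%R && (0 < p.2 < c)%R then phi g p.1 p.2 else 0)
    + (if (0 < p.1 < s)%R && (0 < p.2 < c)%R then psi g p.1 p.2 else 0)); last first.
    by apply/funext => p; rewrite /M; case: ifP; rewrite ?mule0 ?adde0.
  apply: mf_adde; last by apply: mf_if; [mf|apply: mf_psi => //; mf|mf].
  apply: mf_mule; first by mf.
  by apply: (mf_phi g g0 mg); [mf|mf|mf|move=> p /and3P[_ /ltW]].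
have mML : measurable_fun setT (fun r => lint (M r)) by apply: mf_lint2.
have -> : step t Cq n.+1 B x0 l u = lint (fun w => lint (fun r => M r w)).
  transitivity (lint (fun r => lint (fun w => M r w))); last exact: lint_swap.
  transitivity (lint (fun x => lint (M (t - x)%R))); last first.
    by apply: (lint_refl t (fun r => lint (M r))) => // r; exact: lint_ge0.
  apply: lint_ext => x; rewrite /inbox /M subr_gt0 ltrD2l ltrN2 [(x < t)%R && _]andbC.
  case: (boolP (x0 < x < t)%R) => [/andP[xx xt']|_] /=; last by rewrite !lint0.
  rewrite -lint_band// ?subr_gt0//; apply: lint_ext => y; case: ifP => // _.
  case: ifP => [/andP[ly yu]|_]; last by rewrite CqE.
  (* The upper-record term is [psi] at remaining length [t - x] and corange [u - y]: the tested area
     is the state at which the rest of the chain restarts. *)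
  by rewrite CqE//; congr (_ + _); rewrite Cq_le ?ltW// /psi /g /gq muleCA.
rewrite CqE// -/s -/c -gE.
transitivity (lint (fun w => (if (0 < w < c)%R then 1 else 0) * g 0%R + lint (fun r => M r w))).
  apply: lint_ext => w; rewrite /M; case: ifP => [/andP[w0 wc]|_]; last first.
    by rewrite mul0e add0e; under lint_ext do rewrite andbF; rewrite lint0.
  rewrite mul1e phi_ode ?ltW// ?w0 ?(lt_le_trans wc)//; last by rewrite lerBlDr ler_wpDr.
  by congr (_ + _); apply: lint_ext => r; rewrite andbT.
rewrite lintD; last 4 first.
- by nn.
- by nn.
- by mf.
- by apply: (mf_lint2 (fun w r => M r w)) => //; apply: (mf_comp _ (fun p : R * R => (p.2, p.1)) mM); mf.
by rewrite lintZr; [rewrite lint_itvoo ?ltW// subr0|nn|nn|mf].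
Qed.

End QFdd.

(** * Uniqueness by iterating the equation *)

Section Sandwich.
Context {R : realType}.
Variable t : R.
Local Open Scope ereal_scope.
Notation P := (R * R)%type.
Notation family := (nat -> (nat -> set R) -> R -> R -> R -> \bar R).
Implicit Types (F G : family) (B : nat -> set R) (n N k : nat).

Definition mfamily F := forall n B, (forall i, measurable (B i)) ->
  (forall x0 l u, 0 <= F n B x0 l u) /\
  forall d (T : measurableType d) (fx fl fu : T -> R), measurable_fun setT fx ->
    measurable_fun setT fl -> measurable_fun setT fu ->
    measurable_fun setT (fun z => F n B (fx z) (fl z) (fu z)).

Definition integrand F n B x0 l u (p : P) : \bar R :=
  if inbox t x0 p then
    if (l < p.2 < u)%R then
      (if n is n'.+1 then
         (\1_(B 0%N) ((t - p.1) * (u - p.2))%R)%:E * F n' (fun i => B i.+1) p.1 p.2 u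
       else F 0%N B p.1 p.2 u) + F n B p.1 l p.2
    else F n B p.1 l u else 0.

Lemma stepE F n B x0 l u : step t F n B x0 l u = lint2 (integrand F n B x0 l u).
Proof. by []. Qed.

Lemma integrand_ge0 F n B x0 l u p : mfamily F -> (forall i, measurable (B i)) ->
  0 <= integrand F n B x0 l u p.
Proof.
move=> FF mB; have F0 := (FF n B mB).1; have F0' := fun mB' => (FF n.-1 (fun i => B i.+1) mB').1.
rewrite /integrand; case: ifP => // _; case: ifP => // _.
apply: adde_ge0 => //; case: n F0 F0' => [|n] F0 F0' //.
by apply: mule_ge0; [rewrite lee_fin indicE|exact: F0'].
Qed.

Lemma mf_integrand F n B x0 l u : mfamily F -> (forall i, measurable (B i)) ->
  measurable_fun setT (integrand F n B x0 l u).
Proof.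
move=> FF mB; have F0 := (FF n B mB).2.
apply: mf_if; [by apply: mf_inbox; mf| |by mf].
apply: mf_if; [by mf| |by apply: F0; mf].
apply: mf_adde; last by apply: F0; mf.
case: n F0 => [|n] F0; first by apply: F0; mf.
apply: mf_mule; first by mf.
by apply: (FF n (fun i => B i.+1) _).2 => //; mf.
Qed.

Lemma stepD F G n B x0 l u : mfamily F -> mfamily G -> (forall i, measurable (B i)) ->
  step t (fun n B x0 l u => F n B x0 l u + G n B x0 l u) n B x0 l u =
  step t F n B x0 l u + step t G n B x0 l u.
Proof.
move=> FF FG mB; rewrite !stepE -lint2D; last 4 first.
- by move=> p; exact: integrand_ge0.
- by move=> p; exact: integrand_ge0.
- exact: mf_integrand.
- exact: mf_integrand.
apply: lint2_ext => p; rewrite /integrand.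
case: ifP => _; last by rewrite adde0.
case: ifP => _ //; case: n => [|n]; first by rewrite addeACA.
rewrite ge0_muleDr; first by rewrite addeACA.
- exact: (FF n (fun i => B i.+1) _).1.
- exact: (FG n (fun i => B i.+1) _).1.
Qed.

Lemma lint2_le (H H' : P -> \bar R) : (forall p, 0 <= H p) ->
  measurable_fun setT H -> measurable_fun setT H' ->
  (forall p, H p <= H' p) -> lint2 H <= lint2 H'.
Proof.
move=> H0 mH mH' HH'.
have H'0 p : 0 <= H' p by exact: le_trans (HH' p).
apply: lint_le => [x|||x]; [by nn|exact: mf_lint_at|exact: mf_lint_at|].
by apply: lint_le => //; apply: mf_comp => //; mf.
Qed.

(** The parameters on which the equation is solved; an atom in the box leads from valid parameters
    to valid ones, so comparisons on this range pass through [step]. *)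
Definition valid (x0 l u : R) := [/\ (0 <= x0)%R, (x0 < t)%R, (0 <= l)%R, (l < u)%R & (u <= 1)%R].

Lemma step_le F G n B x0 l u : mfamily F -> mfamily G -> (forall i, measurable (B i)) ->
  (forall n B, (forall i, measurable (B i)) ->
    forall x0 l u, valid x0 l u -> F n B x0 l u <= G n B x0 l u) ->
  valid x0 l u -> step t F n B x0 l u <= step t G n B x0 l u.
Proof.
move=> FF FG mB FleG [x00 xt l0 lu u1]; rewrite !stepE; apply: lint2_le.
- by move=> p; exact: integrand_ge0.
- exact: mf_integrand.
- exact: mf_integrand.
move=> p; rewrite /integrand /inbox.
case: ifP => // /andP[/andP[xp pt] _].
have p0 := le_trans x00 (ltW xp).
case: ifP => [/andP[lp pu]|_]; last exact: FleG.
apply: leeD; last by apply: FleG => //; split => //; exact: le_trans (ltW pu) u1.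
case: n => [|n]; first by apply: FleG => //; split => //; exact: le_trans l0 (ltW lp).
apply: lee_wpmul2l; first by rewrite lee_fin indicE.
by apply: FleG => //; split => //; exact: le_trans l0 (ltW lp).
Qed.

Lemma mfamily_V k : mfamily (V t k).
Proof.
move=> n B mB; split; first by move=> *; exact: V_ge0.
by move=> d T fx fl fu mx ml mu; exact: mf_V.
Qed.

Definition Vsum N n B x0 l u := \sum_(k < N) V t k n B x0 l u.

Lemma mfamily_Vsum N : mfamily (Vsum N).
Proof.
move=> n B mB; split; first by move=> *; apply: sume_ge0 => k _; exact: V_ge0.
move=> d T fx fl fu mx ml mu; apply: emeasurable_sum => k.
exact: (mfamily_V k n B mB).2.
Qed.

Lemma mfamily_Cq : mfamily (Cq t).
Proof.
move=> n B mB; split=> [x0 l u|d T fx fl fu mx ml mu].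
  by rewrite /Cq; apply: mule_ge0; [rewrite lee_fin mulr_ge0 ?expR_ge0|exact: qfdd_ge0].
apply: mf_mule; last by apply: (mf_comp _ _ (mf_qfdd n B mB)); mf.
by mf.
Qed.

(** By additivity of [step], the partial sums are the Picard iterates of the equation started from
    0. *)
Lemma Vsum_step N n B x0 l u : (forall i, measurable (B i)) ->
  Vsum N.+1 n B x0 l u = V t 0 n B x0 l u + step t (Vsum N) n B x0 l u.
Proof.
move=> mB; elim: N => [|N IH].
  have S0 n' B' a b c : Vsum 0 n' B' a b c = 0 by rewrite /Vsum big_ord0.
  rewrite {1}/Vsum big_ord_recl big_ord0 stepE; congr (_ + _).
  rewrite -[LHS]lint20; apply: lint2_ext => p; rewrite /integrand; case: ifP => // _.
  by case: ifP => _; rewrite ?S0//; case: (n) => [|n']; rewrite ?S0 ?mule0 ?adde0.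
have -> : Vsum N.+2 n B x0 l u = Vsum N.+1 n B x0 l u + V t N.+1 n B x0 l u.
  by rewrite /Vsum big_ord_recr.
rewrite IH (VS t N n B x0 l u mB) -[LHS]addeA; congr (_ + _).
have <- := stepD (Vsum N) (V t N) n B x0 l u (mfamily_Vsum N) (mfamily_V N) mB.
rewrite !stepE; apply: lint2_ext => p; rewrite /integrand /Vsum.
by case: n {IH} => [|n]; rewrite !big_ord_recr.
Qed.

(* Bounds what is lost by ignoring the configurations of [N] points or more. *)
Definition remainder N n B (x0 l u : R) : \bar R :=
  (expR t * `|u - l| * (`|t - x0| ^+ N / N`!%:R))%:E.

Lemma mfamily_remainder N : mfamily (remainder N).
Proof.
move=> n B mB; split=> [x0 l u|d T fx fl fu mx ml mu].
  by rewrite lee_fin !mulr_ge0 ?expR_ge0 ?exprn_ge0 ?invr_ge0.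
by rewrite /remainder; mf.
Qed.

(** An atom splits the width exactly, so it creates no growth: the heights contribute mass 1, and
    only the integral over the remaining length acts, raising the power by one. *)
Lemma step_remainder N n B x0 l u : (forall i, measurable (B i)) -> valid x0 l u ->
  step t (remainder N) n B x0 l u <= remainder N.+1 n B x0 l u.
Proof.
move=> mB [x00 xt l0 lu u1].
pose c := (u - l)%R.
have c0 : (0 <= c)%R by rewrite subr_ge0 ltW.
pose f r := (if (0 < r < t - x0)%R then (r ^+ N / N`!%:R)%:E else 0).
have f0 r : 0 <= f r.
  by rewrite /f; case: ifP => // /andP[/ltW r0 _]; rewrite lee_fin mulr_ge0 ?exprn_ge0 ?invr_ge0.
have mf : measurable_fun setT f by rewrite /f; mf.
have mf' : measurable_fun setT (fun x : R => f (t - x)%R) by apply: (mf_comp f) => //; mf.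
pose G (p : P) := (expR t * c)%:E * (f (t - p.1)%R * (if (0 < p.2 < 1)%R then 1 else 0)).
have G0 p : 0 <= G p.
  by rewrite /G; apply: mule_ge0; [rewrite lee_fin mulr_ge0 ?expR_ge0|nn].
have mG : measurable_fun setT G.
  by rewrite /G; mf; apply: (mf_comp f) => //; mf.
rewrite stepE; apply: (@le_trans _ _ (lint2 G)).
  apply: lint2_le => //.
  - by move=> p; apply: integrand_ge0 => //; exact: mfamily_remainder.
  - by apply: mf_integrand => //; exact: mfamily_remainder.
  move=> p; rewrite /integrand; case: ifP => // /andP[/andP[xp pt] p01].
  have -> : G p = (expR t * c * ((t - p.1) ^+ N / N`!%:R))%:E.
    by rewrite /G /f p01 mule1 subr_gt0 ltrD2l ltrN2 pt xp /= -EFinM.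
  have tp : (`|t - p.1| = t - p.1)%R by rewrite ger0_norm// subr_ge0 ltW.
  rewrite /remainder tp.
  have b0 : (0 <= (t - p.1) ^+ N / N`!%:R)%R.
    by rewrite mulr_ge0 ?invr_ge0 ?exprn_ge0 ?subr_ge0 ?ltW.
  case: ifP => [/andP[lp pu]|_]; last by rewrite ger0_norm.
  (* The widths of the two possible new bands add up to that of the old one. *)
  have E3 : (expR t * (u - p.2) * ((t - p.1) ^+ N / N`!%:R))%:E
     + (expR t * (p.2 - l) * ((t - p.1) ^+ N / N`!%:R))%:E
     = (expR t * c * ((t - p.1) ^+ N / N`!%:R))%:E.
    by rewrite -EFinD; congr EFin; rewrite /c; ring.
  rewrite -E3; apply: leeD; last by rewrite ger0_norm// subr_ge0 ltW.
  have -> : (`|u - p.2| = u - p.2)%R by rewrite ger0_norm// subr_ge0 ltW.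
  case: n => [|n]; first exact: lexx.
  rewrite indicE; case: (_ \in _); first by rewrite mul1e.
  rewrite mul0e.
  rewrite lee_fin; apply: mulr_ge0 => //; apply: mulr_ge0; first exact: expR_ge0.
  by rewrite subr_ge0 ltW.
rewrite /G lint2Z//; last 3 first.
- by rewrite lee_fin mulr_ge0 ?expR_ge0.
- by move=> p; nn.
- by mf; apply: (mf_comp f) => //; mf.
have -> : lint2 (fun p => f (t - p.1)%R * (if (0 < p.2 < 1)%R then 1 else 0)) = lint (fun x => f (t - x)%R).
  apply: lint_ext => x; rewrite /= lintZ//; [|by nn|by mf].
  by rewrite lint_itvoo// subr0 mule1.
have s0 : (0 <= t - x0)%R by rewrite subr_ge0 ltW.
by rewrite (lint_refl t f)// lint_pow// /remainder -EFinM (ger0_norm c0) (ger0_norm s0).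
Qed.

(** [step] is monotone, so iterates that start at 0, below the nonnegative solution [Cq], stay below
    it. *)
Lemma Vsum_le_Cq N n B : (forall i, measurable (B i)) ->
  forall x0 l u, valid x0 l u -> Vsum N n B x0 l u <= Cq t n B x0 l u.
Proof.
elim: N n B => [|N IH] n B mB x0 l u v.
  by rewrite /Vsum big_ord0; exact: (mfamily_Cq n B mB).1.
have [x00 xt l0 lu u1] := v.
rewrite (Vsum_step N n B x0 l u mB) (Cq_fix t n B x0 l u mB xt l0 lu u1).
apply: leeD; first exact: lexx.
by apply: step_le => //; [exact: mfamily_Vsum|exact: mfamily_Cq].
Qed.

Lemma Cq_le_Vsum N n B : (forall i, measurable (B i)) ->
  forall x0 l u, valid x0 l u ->
  Cq t n B x0 l u <= Vsum N n B x0 l u + remainder N n B x0 l u.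
Proof.
elim: N n B => [|N IH] n B mB x0 l u v; have [x00 xt l0 lu u1] := v.
  (* Here the constant [expR t] of [remainder] originates: [qfdd] is at most 1 and [x0 >= 0]. *)
  rewrite /Vsum big_ord0 add0e /remainder expr0 fact0 divr1 mulr1 /Cq.
  apply: (@le_trans _ _ ((expR (t - x0) * `|u - l|)%:E * 1)).
    apply: lee_wpmul2l; last exact: qfdd_le1.
    by rewrite lee_fin mulr_ge0 ?expR_ge0.
  by rewrite mule1 lee_fin ler_wpM2r// ler_expR gerBl.
rewrite (Vsum_step N n B x0 l u mB) (Cq_fix t n B x0 l u mB xt l0 lu u1).
rewrite -[X in _ <= X]addeA; apply: leeD; first exact: lexx.
pose F n B x0 l u := Vsum N n B x0 l u + remainder N n B x0 l u.
have FF : mfamily F.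
  move=> n' B' mB'; have [S0 mS] := mfamily_Vsum N n' B' mB'.
  have [R0 mR] := mfamily_remainder N n' B' mB'; split => [*|*]; first exact: adde_ge0.
  by apply: mf_adde; [exact: mS|exact: mR].
apply: (@le_trans _ _ (step t F n B x0 l u)).
  by apply: (step_le (Cq t) F) => //; exact: mfamily_Cq.
rewrite stepD//; [|exact: mfamily_Vsum|exact: mfamily_remainder].
by apply: leeD => //; exact: step_remainder.
Qed.

Lemma V_series n B : (0 < t)%R -> (forall i, measurable (B i)) ->
  \sum_(k <oo) V t k n B 0 0 1 = (expR t)%:E * qfdd n B t.
Proof.
move=> t0 mB.
have v : valid 0 0 1 by split.
have -> : (expR t)%:E * qfdd n B t = Cq t n B 0 0 1.
  by rewrite Cq_le// !subr0 !mulr1.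
have V0' k : 0 <= V t k n B 0 0 1 by exact: V_ge0.
apply/le_anti/andP; split.
  apply: lime_le; first exact: is_cvg_nneseries.
  by apply: nearW => N; rewrite big_mkord; exact: Vsum_le_Cq.
apply/lee_addgt0Pr => e e0.
(* On the initial band the remainder is [expR t] times a term of the exponential series at [t],
   which tends to 0. *)
have e1 : (0 < e / expR t)%R by rewrite divr_gt0// expR_gt0.
have [N _ HN] := (@cvgr0_norm_lt _ _ _ _ _ _ (cvg_exp_coeff t)) _ e1.
apply: (le_trans (Cq_le_Vsum N n B mB _ _ _ v)); apply: leeD.
  by rewrite /Vsum -(big_mkord xpredT (fun k => V t k n B 0 0 1)); exact: nneseries_lim_ge.
rewrite /remainder !subr0 normr1 mulr1 lee_fin gtr0_norm//.
have := HN N (leqnn N); rewrite exp_coeffE /= mulrC => /ltW h.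
have := le_trans (ler_norm _) h; rewrite ler_pdivlMr ?expR_gt0// => h2.
by apply: le_trans h2; rewrite le_eqVlt; apply/orP; left; apply/eqP; ring.
Qed.

End Sandwich.

(** * From the Poisson expectation to the band integrals *)

Lemma int_pts_Jord (R : realType) (t : R) k n (B : nat -> set R) h :
  (forall i, measurable (B i)) -> (0 < h < 1)%R ->
  int_pts t k (fun pts => (\prod_(i < n.+1) \1_(B i) (Xseq t h pts i))%:E) =
  ((k`!%:R * \1_(B 0) t)%:E * Jord t k 0 (W t n (fun i => B i.+1) h 0 1))%E.
Proof.
move=> mB h01.
have mB' i : measurable (B i.+1) by [].
pose G (_ : unit) s := ((\1_(B 0) t)%:E * W t n (fun i => B i.+1) h 0 1 s)%E.
have G0 z s : (0 <= G z s)%E.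
  by apply: mule_ge0; [rewrite lee_fin indicE|exact: W_ge0].
have mG : mseq G.
  move=> d S a ps ma mps; apply: mf_mule; first by mf.
  by apply: (mseq_W t n _ mB' _ S (fun=> (h, 0, 1)) ps); mf.
(* Off a null set the areas depend only on the sorted configuration, and the deterministic state at
   index 0 is a constant factor. *)
rewrite (int_pts_Junord t k _ (fun z s => G z (isort s)) tt [::])//.
- by rewrite Junord_isort// Jord_indic EFinM muleA.
- exact: mseq_isort.
- move=> s /andP[us ys]; rewrite cats0 in us.
  rewrite big_ord_recl /G /W -EFinM; congr (_ * _)%:E.
  by apply: eq_bigr => i _; rewrite -Xseq_areas.
Qed.

Theorem theorem6 (R : realType) (t : R) (ht : 0 < t)
  (n : nat) (B : nat -> set R) (hB : forall i, measurable (B i)) :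
  records_fdd t n B = Q_fdd t n B.
Proof.
have mB' i : measurable (B i.+1) by [].
pose b := (\1_(B 0) t : R).
have b0 : 0 <= b by rewrite /b indicE.
pose f k h : \bar R := (if (0 < h < 1)%R then Jord t k 0 (W t n (fun i => B i.+1) h 0 1) else 0)%E.
have f0 k h : (0 <= f k h)%E.
  by rewrite /f; case: ifP => // _; apply: Jord_ge0 => s; exact: W_ge0.
have mf k : measurable_fun setT (f k).
  by rewrite /f; apply: mf_if; [mf|apply: mf_Jord_W => //; mf|mf].
have mF : measurable_fun setT (fun h => (\sum_(k <oo) f k h)%E).
  by apply: ge0_emeasurable_sum.
have F0 h : (0 <= \sum_(k <oo) f k h)%E by apply: nneseries_ge0.
rewrite /records_fdd (lint_bool (fun h => 0 <= h <= 1)).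
transitivity (lint (fun h => (expR (- t) * b)%:E * (\sum_(k <oo) f k h))%E).
  apply: (lint_eq_off [:: 0; 1]); first by mf.
  move=> h; rewrite !inE negb_or => /andP[h0 h1].
  have -> : (0 <= h <= 1) = (0 < h < 1).
    by rewrite !lt_neqAle (eq_sym 0) h0 h1.
  rewrite -nneseriesZl//; case: ifP => [h01|hn].
    apply: eq_eseriesr => k _; rewrite /f h01 int_pts_Jord// muleA -EFinM.
    (* The number of orderings cancels the factorial of the Janossy density. *)
    congr (_%:E * _)%E; rewrite -/b; field.
    by rewrite pnatr_eq0 -lt0n fact_gt0.
  by rewrite eseries0// => k _ _; rewrite /f hn mule0.
rewrite lintZ//; last by rewrite lee_fin mulr_ge0 ?expR_ge0.
have -> : lint (fun h => (\sum_(k <oo) f k h)%E) = (\sum_(k <oo) V t k n (fun i => B i.+1) 0 0 1)%E.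
  by rewrite lint_nneseries.
(* On the initial band the width is 1 and the factor [expR t] cancels the Poisson normalisation
   [expR (- t)]. *)
by rewrite V_series// muleA -EFinM mulrAC -expRD addNr expR0 mul1r.
Qed.
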